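(* Let $(G,\cdot)$ be a locally compact Polish group and $X$ be a locally compact Polish space having more than one point for which $(\operatorname{card}(G),\operatorname{card}(X)) \neq (1,2)$. There exists $d \in \operatorname{Metr}_c(G \times X)$ such that $\operatorname{Iso}(G \times X,d)$ consists precisely of all maps of the form $(g,x) \mapsto (ag,x)$ $(a \in G)$. In particular, $\operatorname{Iso}(G \times X,d)$ acts freely on $G \times X$ and is isomorphic (as a topological group) to $G$.
   Context: A topological space or group is Polish if it is separable and completely metrizable. A metric is proper if all closed balls with respect to it are compact. For a locally compact Polish space $Y$, $\operatorname{Metr}_c(Y)$ is the set of all proper metrics on $Y$ which induce the topology of $Y$. $\operatorname{Iso}(Y,d)$ is the group of all bijective isometries of $(Y,d)$, equipped with the topology of pointwise convergence. A group of transformations acts freely if only its neutral element has a fixed point. Isomorphisms between topological groups are group isomorphisms that are homeomorphisms. *)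

(* Defs.v *)
From HB Require Import structures.
From mathcomp Require Import all_boot all_order all_algebra.
From mathcomp Require Import all_classical all_reals topology.

Set Implicit Arguments.
Unset Strict Implicit.
Unset Printing Implicit Defensive.

Import Order.TTheory GRing.Theory Num.Theory.
Local Open Scope classical_set_scope.
Local Open Scope ring_scope.

(* The multiplicative counterparts of TopologicalZmodule and its parents. *)
#[short(type="preTopologicalGroupType")]
HB.structure Definition PreTopologicalGroup :=
  {G of Topological G & monoid.Group G}.

HB.mixin Record PreTopologicalGroup_isTopologicalGroup G
    & PreTopologicalGroup G := {
  mulg_continuous : continuous (fun x : G * G => (x.1 * x.2)%g) ;
  invg_continuous : continuous (fun x : G => (x^-1)%g)
}.

#[short(type="topologicalGroupType")]
HB.structure Definition TopologicalGroup :=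
  {G of PreTopologicalGroup G & PreTopologicalGroup_isTopologicalGroup G}.

Definition topgroup_isomorphic (G H : preTopologicalGroupType) : Prop :=
  exists (f : G -> H) (g : H -> G),
    [/\ {morph f : x y / (x * y)%g}, cancel f g, cancel g f,
        continuous f & continuous g].

(* Metrics are plain functions, since several of them are considered on one
   topological space; the clauses are those of the factory isMetric. *)
Definition is_metric (R : realType) (T : Type) (d : T -> T -> R) : Prop :=
  [/\ forall x, d x x = 0,
      forall x y, d x y = 0 -> x = y,
      forall x y, d x y = d y x &
      forall y x z, d x z <= d x y + d y z].

Definition induces_topology (R : realType) (T : topologicalType)
    (d : T -> T -> R) : Prop :=
  forall x : T, nbhs x = nbhs_ball_ (fun y e => [set z | d y z < e]) x.

Definition complete_metric (R : realType) (T : Type) (d : T -> T -> R) : Prop :=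
  forall u : nat -> T,
    (forall e, 0 < e ->
       exists N : nat, forall m n, (N <= m)%N -> (N <= n)%N ->
         d (u m) (u n) < e) ->
    exists l : T, forall e, 0 < e ->
      exists N : nat, forall n, (N <= n)%N -> d (u n) l < e.

Definition proper_metric (R : realType) (T : topologicalType)
    (d : T -> T -> R) : Prop :=
  forall (x : T) (r : R), compact [set y | d x y <= r].

Definition separable (T : topologicalType) : Prop :=
  exists2 D : set T, countable D & dense D.

Definition completely_metrizable (R : realType) (T : topologicalType) : Prop :=
  exists d : T -> T -> R,
    [/\ is_metric d, induces_topology d & complete_metric d].

Definition polish (R : realType) (T : topologicalType) : Prop :=
  separable T /\ completely_metrizable R T.

(* Compactness in [proper_metric] refers to the given topology of T, which is
   the one of d because of [induces_topology]. *)
Definition Metr_c (R : realType) (T : topologicalType) : set (T -> T -> R) :=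
  [set d | [/\ is_metric d, induces_topology d & proper_metric d]].
Arguments Metr_c R T : clear implicits.

Definition isometries (R : realType) (T : Type) (d : T -> T -> R) :
    set (T -> T) :=
  [set f | bijective f /\ forall x y, d (f x) (f y) = d x y].

(* The topology of pointwise convergence is taken with respect to the topology
   of T, hence it is the one of (T, d) only when [induces_topology d]. *)
Definition Iso (R : realType) (T : topologicalType) (d : T -> T -> R) : Type :=
  set_type (isometries d : set {ptws T -> T}).

Section IsoGroup.
Variables (R : realType) (T : topologicalType) (d : T -> T -> R).

HB.instance Definition _ := Topological.copy (Iso d)
  (set_type (isometries d : set {ptws T -> T})).

Definition iso_fun (f : Iso d) : T -> T := set_val f.

Lemma iso_funP (f : Iso d) : isometries d (iso_fun f).
Proof. exact: set_valP. Qed.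

Lemma iso_inj (f g : Iso d) : iso_fun f =1 iso_fun g -> f = g.
Proof. by move=> fg; apply: val_inj; apply: funext. Qed.

Definition mk_iso (f : T -> T) (fP : isometries d f) : Iso d :=
  exist _ (f : {ptws T -> T}) (mem_set fP).

Lemma isometries_id : isometries d idfun.
Proof. by split=> //; exists idfun. Qed.

Lemma isometries_comp (f g : T -> T) :
  isometries d f -> isometries d g -> isometries d (f \o g).
Proof.
move=> [fb fd] [gb gd]; split; first exact: bij_comp.
by move=> x y; rewrite /= fd gd.
Qed.

Lemma isometries_has_inv (f : T -> T) : isometries d f ->
  exists g, [/\ isometries d g, cancel f g & cancel g f].
Proof.
move=> [[g fK gK] fd]; exists g; split=> //; split; first by exists f.
by move=> x y; rewrite -fd !gK.
Qed.

Definition iso_one : Iso d := mk_iso isometries_id.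

Definition iso_mul (f g : Iso d) : Iso d :=
  mk_iso (isometries_comp (iso_funP f) (iso_funP g)).

Definition iso_inv (f : Iso d) : Iso d :=
  let: exist _ gP := cid (isometries_has_inv (iso_funP f)) in
  let: And3 gI _ _ := gP in mk_iso gI.

Lemma iso_invK (f : Iso d) : cancel (iso_fun (iso_inv f)) (iso_fun f).
Proof. by rewrite /iso_inv; case: cid => g [gI fK gK]. Qed.

Lemma iso_invVK (f : Iso d) : cancel (iso_fun f) (iso_fun (iso_inv f)).
Proof. by rewrite /iso_inv; case: cid => g [gI fK gK]. Qed.

Lemma iso_mulA : associative iso_mul.
Proof. by move=> f g h; apply: iso_inj. Qed.

Lemma iso_mul1f : left_id iso_one iso_mul.
Proof. by move=> f; apply: iso_inj. Qed.

Lemma iso_mulf1 : right_id iso_one iso_mul.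
Proof. by move=> f; apply: iso_inj. Qed.

Lemma iso_mulVf : left_inverse iso_one iso_inv iso_mul.
Proof. by move=> f; apply: iso_inj => x; exact: iso_invVK. Qed.

Lemma iso_mulfV : right_inverse iso_one iso_inv iso_mul.
Proof. by move=> f; apply: iso_inj => x; exact: iso_invK. Qed.

HB.instance Definition _ := isGroup.Build (Iso d)
  iso_mulA iso_mul1f iso_mulf1 iso_mulVf iso_mulfV.

Definition iso_acts_freely : Prop :=
  forall f : Iso d, (exists x : T, iso_fun f x = x) -> f = 1%g.

End IsoGroup.
Arguments iso_acts_freely {R T} d.

(* Main.v *)
(* Let rho be a proper metric on Y = G x X invariant under left translations: the
   sum of Struble's left-invariant metric on G and of a proper metric on X.  Call
   two pairs of points equivalent when a translation, possibly followed by a swap,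
   maps one to the other, and let beta be the distance between orbits of pairs.
   For a dense sequence of off-diagonal pairs s_i put
     d = sqrt rho + sum_i a_i max(0, r_i - sqrt (beta (s_i, .))).
   Since sqrt rho satisfies the triangle inequality with room to spare and every
   bump is 1-Lipschitz for sqrt rho, small weights keep d a metric.  Relative to
   the scale sqrt rho, both sqrt rho off the diagonal and each bump away from its
   centre have slope zero, so d has a peak of slope comparable to a_i at the orbit
   of s_i and slope zero elsewhere.  With a_i = 8^-(i+1) isometries therefore
   preserve the orbit of each s_i; isolated orbits, where slopes say nothing, are
   instead given pairwise distinct distances.  By density an isometry maps every
   pair to an equivalent one, and the cardinality assumption forces such a map to
   be a left translation. *)
Require Import Defs.
From mathcomp Require Import all_boot all_order all_algebra lra.
From mathcomp Require Import all_classical all_reals topology normedtype sequences.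

Set Implicit Arguments.
Unset Strict Implicit.
Unset Printing Implicit Defensive.

Import Order.TTheory GRing.Theory Num.Theory.
Import numFieldNormedType.Exports.

Local Open Scope classical_set_scope.
Local Open Scope ring_scope.

(** * Square roots and series *)

Section SquareRoots.
Context {R : realType}.
Implicit Types a b c : R.

Lemma sqrt_dist a b c : 0 <= a -> 0 <= b -> `|a - b| <= c ->
  `|Num.sqrt a - Num.sqrt b| <= Num.sqrt c.
Proof.
wlog ab : a b / a <= b.
  move=> H a0 b0; case: (leP a b) => [|/ltW] ab; first exact: H.
  by rewrite distrC => ?; rewrite distrC; apply: H.
move=> a0 b0 abc; rewrite distrC ger0_norm ?subr_ge0 ?ler_sqrt// lerBlDl.
have c0 : 0 <= c := le_trans (normr_ge0 _) abc.
rewrite -(@ler_pXn2r _ 2%N) ?nnegrE ?addr_ge0 ?sqrtr_ge0//.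
rewrite sqrrD !sqr_sqrtr//.
have := ler_norm (b - a); rewrite distrC => h.
have : 0 <= Num.sqrt a * Num.sqrt c by rewrite mulr_ge0 ?sqrtr_ge0.
by rewrite mulr2n; lra.
Qed.

(** Factor [a - b] as a difference of squares of roots. Away from zero the root is thus Lipschitz,
    which is the source of all slopes equal to zero below. *)
Lemma sqrt_dist_pos a b : 0 <= a -> 0 < b ->
  `|Num.sqrt a - Num.sqrt b| <= `|a - b| / Num.sqrt b.
Proof.
move=> a0 b0; have sb : 0 < Num.sqrt b by rewrite sqrtr_gt0.
rewrite ler_pdivlMr//; have -> : a - b = (Num.sqrt a - Num.sqrt b) * (Num.sqrt a + Num.sqrt b).
  by rewrite -subr_sqr !sqr_sqrtr// ltW.
rewrite normrM ler_wpM2l// ger0_norm ?addr_ge0 ?sqrtr_ge0//.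
by rewrite lerDr sqrtr_ge0.
Qed.

(** For [a <= b] the product of the roots is at least [a], so squaring gives
    [sqrt (a + b) <= sqrt b + sqrt a / 2]. The slack of half the smaller root later absorbs the
    bumps. *)
Lemma sqrt_triangle a b c : 0 <= a -> 0 <= b -> c <= a + b ->
  Num.min (Num.sqrt a) (Num.sqrt b) / 2 + Num.sqrt c <= Num.sqrt a + Num.sqrt b.
Proof.
wlog ab : a b / a <= b.
  move=> H a0 b0; case: (leP a b) => [|/ltW] ab; first exact: H.
  by rewrite addrC => ?; rewrite minC [leRHS]addrC; apply: H.
move=> a0 b0 cab; rewrite (min_idPl _) ?ler_sqrt// -lerBrDl.
have s : Num.sqrt a <= Num.sqrt b by rewrite ler_sqrt.
apply: (@le_trans _ _ (Num.sqrt (a + b))); first by rewrite ler_sqrt// addr_ge0.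
have sa := sqrtr_ge0 a.
rewrite -(@ler_pXn2r _ 2%N) ?nnegrE ?sqrtr_ge0//; last by lra.
rewrite sqr_sqrtr ?addr_ge0//.
rewrite -{1}(sqr_sqrtr a0) -{1}(sqr_sqrtr b0); nra.
Qed.

End SquareRoots.

(** * Series dominated by geometric weights *)

Section WeightedSeries.
Context {R : realType}.
Implicit Types u v : nat -> R.

(** The ratio 1/8 serves twice: all weights add up to less than 1/4, and consecutive weights differ
    by more than the factor 6 lost when slopes are estimated. *)
Definition eps (i : nat) : R := 8%:R^-1 ^+ i.+1.

Lemma eps_gt0 i : 0 < eps i.
Proof. by rewrite exprn_gt0// invr_gt0. Qed.

Lemma eps_ge0 i : 0 <= eps i. Proof. exact/ltW/eps_gt0. Qed.

Lemma epsS i : eps i.+1 = eps i / 8.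
Proof. by rewrite /eps exprSr. Qed.

Lemma eps_le i j : (i <= j)%N -> eps j <= eps i.
Proof.
move=> ij; rewrite /eps ler_wiXn2l//; lra.
Qed.

Lemma eps_geP i j : eps i / 6 <= eps j -> (j <= i)%N.
Proof.
move=> h; rewrite leqNgt; apply/negP => /eps_le; rewrite epsS; have := eps_gt0 i; lra.
Qed.

Definition eps_bounded u := exists c, forall i, `|u i| <= c * eps i.

Definition ssum u : R := limn (series u).

Lemma ssum_cvg u : eps_bounded u -> cvgn (series u).
Proof.
move=> [c uc]; apply: normed_cvg; apply: (@series_le_cvg _ _ (fun i => c * eps i)).
- by move=> n; exact: normr_ge0.
- by move=> n; exact: le_trans (uc n).
- by move=> n; exact: uc.
have -> : (fun i => c * eps i) = geometric (c / 8%:R) (8%:R^-1).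
  by apply/funext => i; rewrite /geometric /= /eps exprS mulrA.
apply: is_cvg_geometric_series; rewrite ger0_norm; lra.
Qed.

Lemma eps_boundedD u v : eps_bounded u -> eps_bounded v ->
  eps_bounded (fun i => u i + v i).
Proof.
move=> [c uc] [c' vc]; exists (c + c') => i.
by rewrite (le_trans (ler_normD _ _))// mulrDl lerD.
Qed.

Lemma eps_boundedN u : eps_bounded u -> eps_bounded (fun i => - u i).
Proof. by move=> [c uc]; exists c => i; rewrite normrN. Qed.

Lemma ssumD u v : eps_bounded u -> eps_bounded v ->
  ssum (fun i => u i + v i) = ssum u + ssum v.
Proof.
move=> /ssum_cvg hu /ssum_cvg hv; rewrite /ssum -limD//; congr (limn _).
apply/funext => n; rewrite /series /=; exact: big_split.
Qed.

Lemma ssumN u : eps_bounded u -> ssum (fun i => - u i) = - ssum u.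
Proof.
move=> /ssum_cvg hu; rewrite /ssum -limN//; congr (limn _).
by apply/funext => n; rewrite /series /= sumrN.
Qed.

Lemma ssumB u v : eps_bounded u -> eps_bounded v ->
  ssum (fun i => u i - v i) = ssum u - ssum v.
Proof. by move=> hu hv; rewrite ssumD ?ssumN//; exact: eps_boundedN. Qed.

Lemma ssum_tail u c N : (forall i, `|u i| <= c * eps i) ->
  `|ssum u - \sum_(0 <= i < N) u i| <= c * (2 * eps N).
Proof.
move=> uc; have c0 : 0 <= c.
  by have := uc 0%N; have := normr_ge0 (u 0%N); have := eps_gt0 0; nra.
(* The subtracted term lets the induction close: the new summand is at most [c * eps (N + k)], and
   the bound grows by [7 / 4] of this. *)
have H k : `|\sum_(N <= i < N + k) u i| <= c * (2 * eps N) - c * (2 * eps (N + k)).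
  elim: k => [|k IH]; first by rewrite addn0 subrr big_geq// normr0.
  rewrite addnS big_nat_recr ?leq_addr//=.
  apply: (le_trans (ler_normD _ _)); have := uc (N + k)%N.
  rewrite epsS; move: IH; have := eps_gt0 (N + k); nra.
have cv := @ssum_cvg u (ex_intro _ c uc).
suff : (fun n => `|series u n - series u N|) @ \oo --> `|ssum u - \sum_(0 <= i < N) u i|.
  move=> /(cvg_lim (@Rhausdorff R)) <-; apply: limr_le.
    apply: is_cvg_norm; apply: is_cvgB => //; exact: is_cvg_cst.
  near=> n; have Nn : (N <= n)%N by near: n; exact: nbhs_infty_ge.
  rewrite /series /= (big_cat_nat (leq0n N) Nn)/= addrAC subrr add0r -(subnKC Nn).
  apply: (le_trans (H _)); rewrite gerBl.
  by have := eps_gt0 (N + (n - N)); nra.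
apply: cvg_norm; apply: cvgB; [exact: cv|exact: cvg_cst].
Unshelve. all: by end_near. Qed.

Lemma ssum_le u c : (forall i, `|u i| <= c * eps i) -> `|ssum u| <= c / 4.
Proof.
by move=> /(ssum_tail 0); rewrite big_geq// subr0 /eps expr1; lra.
Qed.

Lemma ssum_ge0 u : eps_bounded u -> (forall i, 0 <= u i) -> 0 <= ssum u.
Proof.
move=> /ssum_cvg cv u0; apply: limr_ge => //.
by apply: nearW => n; apply: sumr_ge0.
Qed.

Lemma ssum1 u j : (forall i, i != j -> u i = 0) -> ssum u = u j.
Proof.
move=> uj; apply: (cvg_lim (@Rhausdorff R)).
apply: cvg_near_cst; near=> n.
have jn : (j < n)%N by near: n; exact: nbhs_infty_gt.
rewrite /series /= big_mkord (bigD1 (Ordinal jn))//= big1 ?addr0// => i ij.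
by apply: uj.
Unshelve. all: by end_near. Qed.

Lemma ssum_ge u j : eps_bounded u -> (forall i, 0 <= u i) -> u j <= ssum u.
Proof.
move=> bu u0; pose v i := if i == j then u j else 0.
have bv : eps_bounded v.
  have [c uc] := bu; exists c => i; apply: le_trans (uc i).
  by rewrite /v; case: eqP => [->|_]//; rewrite normr0.
have vj : ssum v = u j by rewrite (ssum1 (j := j)) /v ?eqxx// => i /negPf ->.
rewrite -vj -subr_ge0 -ssumB//; apply: ssum_ge0.
  by apply: eps_boundedD => //; exact: eps_boundedN.
by move=> i; rewrite /v; case: eqP => [->|_]; rewrite ?subrr ?subr0.
Qed.

Lemma eps_small (t : R) : 0 < t -> exists N, eps N < t.
Proof.
move=> t0; have [n nt] : exists n, t^-1 < n.+1%:R.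
  by exists (Num.truncn t^-1); exact: truncnS_gt.
exists n; apply: (@lt_trans _ _ (n.+1%:R^-1)).
  rewrite /eps exprVn ltf_pV2 ?posrE ?exprn_gt0// -natrX ltr_nat.
  exact: ltn_expl.
by rewrite -[t]invrK ltf_pV2 ?posrE ?invr_gt0.
Qed.

(** The coefficients are chosen one after another: the candidates [eps n / k.+1] give infinitely
    many values, of which only finitely many are already taken. *)
Lemma injective_values (w r : nat -> R) : (forall i, 0 < r i) ->
  exists c, (forall i, 0 < c i <= eps i) /\ injective (fun i => w i + c i * r i).
Proof.
move=> r0; have /choice[h hP] (nl : nat * seq R) :
    exists x, 0 < x <= eps nl.1 /\ w nl.1 + x * r nl.1 \notin nl.2.
  case: nl => n l /=; pose x k : R := eps n / k.+1%:R.
  pose v k := w n + x k * r n.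
  have vI : injective v.
    move=> i j /addrI /(mulIf (lt0r_neq0 (r0 n))).
    move=> /(mulfI (lt0r_neq0 (eps_gt0 n))) /invr_inj /eqP.
    by rewrite eqr_nat => /eqP [].
  have [k kl] : exists k, v k \notin l.
    apply: contrapT => H.
    have := @uniq_leq_size _ (map v (iota 0 (size l).+1)) l.
    rewrite size_map size_iota ltnn map_inj_uniq ?iota_uniq// => /(_ isT).
    suff sub : {subset map v (iota 0 (size l).+1) <= l} by move=> /(_ sub).
    move=> _ /mapP[k _ ->]; apply: contrapT => /negP kl.
    by apply: H; exists k.
  exists (x k); split => //; rewrite /x divr_gt0 ?eps_gt0//=.
  by rewrite ler_pdivrMr// ler_peMr ?ler1n// ltW ?eps_gt0.
(* [l n] lists the values given to the indices below [n]. *)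
pose fix l n := if n is m.+1 then (w m + h (m, l m) * r m) :: l m else [::].
exists (fun n => h (n, l n)); split; first by move=> i; case: (hP (i, l i)).
have ml i j : (i < j)%N -> w i + h (i, l i) * r i \in l j.
  elim: j => //= j IH; rewrite ltnS leq_eqVlt => /orP[/eqP ->|/IH ij].
    by rewrite mem_head.
  by rewrite in_cons ij orbT.
have H i j : (i < j)%N -> w i + h (i, l i) * r i <> w j + h (j, l j) * r j.
  by move=> /ml + e; rewrite e; apply/negP; case: (hP (j, l j)).
by move=> i j e; case: (ltngtP i j) => // /H []; rewrite e.
Qed.

End WeightedSeries.

(** * Rigid metrics from bumps on pairs of points *)

Lemma max0_dist {R : realType} (x y : R) :
  `|Num.max 0 x - Num.max 0 y| <= `|x - y|.
Proof.
by case: (leP 0 x) => ?; case: (leP 0 y) => ?; rewrite ?subrr ?normr0//;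
  rewrite ler_norml; have := ler_norm (x - y); have := ler_norm (y - x);
  rewrite [`|y - x|]distrC; lra.
Qed.

Lemma metric_ge0 {R : realType} {T : Type} (d : T -> T -> R) x y :
  is_metric d -> 0 <= d x y.
Proof. by move=> [d1 _ ds dt]; have := dt y x x; rewrite d1 (ds y x); lra. Qed.

Section PairSystem.
Context {R : realType} {Y : Type} (rho : Y -> Y -> R).
Context (rho_metric : is_metric rho).

Let rhoxx x : rho x x = 0. Proof. by case: rho_metric. Qed.
Let rho0 x y : rho x y = 0 -> x = y. Proof. by case: rho_metric => _ + _ _; exact. Qed.
Let rhoC x y : rho x y = rho y x. Proof. by case: rho_metric. Qed.
Let rhoT y x z : rho x z <= rho x y + rho y z. Proof. by case: rho_metric. Qed.
Let rho_ge0 x y : 0 <= rho x y. Proof. exact: metric_ge0. Qed.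

(** * Pairs of points and functions of slope zero *)

Definition pdist (d : Y -> Y -> R) (P Q : Y * Y) := d P.1 Q.1 + d P.2 Q.2.
Definition snow (P Q : Y * Y) := Num.sqrt (pdist rho P Q).
Local Notation m0 := (pdist rho).

Lemma pdist_ge0 P Q : 0 <= m0 P Q. Proof. exact: addr_ge0. Qed.
Lemma pdistC P Q : m0 P Q = m0 Q P.
Proof. by rewrite /pdist rhoC [rho P.2 _]rhoC. Qed.
Lemma pdistxx P : m0 P P = 0. Proof. by rewrite /pdist !rhoxx addr0. Qed.
Lemma pdistT Q P S : m0 P S <= m0 P Q + m0 Q S.
Proof. by rewrite /pdist; have := rhoT Q.1 P.1 S.1; have := rhoT Q.2 P.2 S.2; lra. Qed.
Lemma snow_ge0 P Q : 0 <= snow P Q. Proof. exact: sqrtr_ge0. Qed.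
Lemma snow_sqr P Q : snow P Q ^+ 2 = m0 P Q.
Proof. by rewrite sqr_sqrtr// pdist_ge0. Qed.

Lemma rho_pdist P Q : `|rho P.1 P.2 - rho Q.1 Q.2| <= m0 P Q.
Proof.
rewrite /pdist ler_norml.
have := rhoT Q.1 P.1 P.2; have := rhoT Q.2 Q.1 P.2.
have := rhoT P.1 Q.1 Q.2; have := rhoT P.2 P.1 Q.2.
rewrite (rhoC Q.1 P.1) (rhoC Q.2 P.2); lra.
Qed.

(** Slope zero at [P] relative to [snow], the square root of the sum metric on pairs. *)
Definition flat (F : Y * Y -> R) (P : Y * Y) := forall e, 0 < e ->
  exists2 t, 0 < t & forall Q, snow P Q < t -> `|F P - F Q| <= e * snow P Q.

Lemma flat_cst c P : flat (fun=> c) P.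
Proof.
move=> e e0; exists 1 => // Q _; rewrite subrr normr0 mulr_ge0 ?snow_ge0//.
exact: ltW.
Qed.

Lemma flatD F G P : flat F P -> flat G P -> flat (fun Q => F Q + G Q) P.
Proof.
move=> fF fG e e0; have e2 : 0 < e / 2 by lra.
have [t t0 tF] := fF _ e2; have [u u0 uG] := fG _ e2.
exists (Num.min t u); first by rewrite lt_min t0.
move=> Q; rewrite lt_min => /andP[/tF hF /uG hG].
rewrite (_ : _ - _ = (F P - F Q) + (G P - G Q)); last by lra.
by rewrite (le_trans (ler_normD _ _))//; lra.
Qed.

Lemma flat_sum (F : nat -> Y * Y -> R) n P : (forall i, flat (F i) P) ->
  flat (fun Q => \sum_(0 <= i < n) F i Q) P.
Proof.
move=> fF; elim: n => [|n IH].
  by rewrite (_ : (fun Q => _) = fun=> 0); [exact: flat_cst|];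
    apply/funext => Q; rewrite big_geq.
rewrite (_ : (fun Q => _) = fun Q => \sum_(0 <= i < n) F i Q + F n Q).
  exact: flatD.
by apply/funext => Q; rewrite big_nat_recr.
Qed.

Lemma flat_dominated F G c P : 0 <= c ->
  (forall Q, `|F P - F Q| <= c * `|G P - G Q|) -> flat G P -> flat F P.
Proof.
move=> c0 FG fG e e0; have [|t t0 tG] := fG (e / (c + 1)).
  by rewrite divr_gt0//; lra.
exists t => // Q /tG h; apply: (le_trans (FG Q)).
apply: (@le_trans _ _ (c * (e / (c + 1) * snow P Q))); first exact: ler_wpM2l.
rewrite mulrA ler_wpM2r ?snow_ge0// mulrA ler_pdivrMr; nra.
Qed.

(* The increments of [h] are of the order of the square of [snow]. *)
Lemma flat_sqrt (h : Y * Y -> R) P : (forall Q, 0 <= h Q) -> 0 < h P ->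
  (forall Q, `|h P - h Q| <= m0 P Q) -> flat (fun Q => Num.sqrt (h Q)) P.
Proof.
move=> h0 hP hl e e0; have sP : 0 < Num.sqrt (h P) by rewrite sqrtr_gt0.
exists (e * Num.sqrt (h P)); first exact: mulr_gt0.
move=> Q sQ; rewrite distrC; apply: (le_trans (sqrt_dist_pos (h0 Q) hP)).
rewrite distrC ler_pdivrMr// (le_trans (hl Q))// -snow_sqr expr2 mulrAC.
by rewrite ler_wpM2r ?snow_ge0// ltW.
Qed.

(** * Orbits of pairs and the distance between them *)

Context (same : Y * Y -> Y * Y -> Prop).
Context (sameR : forall P, same P P) (sameS : forall P Q, same P Q -> same Q P)
  (sameT : forall Q P S, same P Q -> same Q S -> same P S)
  (same_swap : forall p q, same (p, q) (q, p))
  (same_iso : forall P P' Q, same P P' ->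
     exists2 Q', same Q Q' & m0 P' Q' = m0 P Q)
  (same_closed : forall P Q,
     (forall t, 0 < t -> exists2 P', same P P' & m0 P' Q < t) -> same P Q)
  (same_rho : forall P Q, same P Q -> rho P.1 P.2 = rho Q.1 Q.2).

(** Moving only the first pair suffices: by [same_iso] a move of [Q] can be undone while carrying
    [P'] along at the same distance. *)
Definition orbit_dist P Q := inf [set m0 P' Q | P' in same P].
Local Notation beta := orbit_dist.

Let beta_has_inf P Q : has_inf [set m0 P' Q | P' in same P].
Proof.
split; first by exists (m0 P Q), P.
by exists 0 => _ [P' _ <-]; exact: pdist_ge0.
Qed.

Lemma orbit_dist_le P P' Q : same P P' -> beta P Q <= m0 P' Q.
Proof. by move=> PP'; apply: ge_inf; [case: (beta_has_inf P Q)|exists P']. Qed.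

Lemma orbit_dist_glb P Q c :
  (forall P', same P P' -> c <= m0 P' Q) -> c <= beta P Q.
Proof.
move=> H; apply: lb_le_inf; first by case: (beta_has_inf P Q).
by move=> _ [P' PP' <-]; exact: H.
Qed.

Lemma orbit_dist_ge0 P Q : 0 <= beta P Q.
Proof. by apply: orbit_dist_glb => P' _; exact: pdist_ge0. Qed.

Lemma orbit_dist_lt P Q t : beta P Q < t ->
  exists2 P', same P P' & m0 P' Q < t.
Proof.
move=> bt; apply: contrapT => H; suff : t <= beta P Q by lra.
apply: orbit_dist_glb => P' PP'; rewrite leNgt; apply/negP => h.
by apply: H; exists P'.
Qed.

Lemma orbit_dist_lip P Q Q' : `|beta P Q - beta P Q'| <= m0 Q Q'.
Proof.
have H Q1 Q2 : beta P Q1 - m0 Q1 Q2 <= beta P Q2.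
  apply: orbit_dist_glb => P' /(orbit_dist_le Q1) h.
  by have := pdistT Q2 P' Q1; rewrite (pdistC Q2 Q1); lra.
by have := H Q Q'; have := H Q' Q; rewrite (pdistC Q' Q) ler_norml; lra.
Qed.

Lemma orbit_dist_same P Q Q' : same Q Q' -> beta P Q = beta P Q'.
Proof.
have H Q1 Q2 : same Q1 Q2 -> beta P Q1 <= beta P Q2.
  move=> Q12; apply: orbit_dist_glb => P' PP'.
  have [P'' P'P'' e] := same_iso P' (sameS Q12).
  rewrite pdistC -e pdistC; apply: orbit_dist_le; exact: sameT P'P''.
by move=> QQ'; apply/eqP; rewrite eq_le !H//; exact: sameS.
Qed.

Lemma orbit_dist_eq0 P Q : same P Q -> beta P Q = 0.
Proof.
move=> PQ; apply/eqP; rewrite eq_le orbit_dist_ge0 andbT.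
by rewrite -(pdistxx Q) orbit_dist_le.
Qed.

Lemma orbit_dist_gt0 P Q : ~ same P Q -> 0 < beta P Q.
Proof.
move=> nPQ; rewrite lt_neqAle orbit_dist_ge0 andbT; apply/eqP => b0.
apply: nPQ; apply: same_closed => t t0.
by apply: orbit_dist_lt; rewrite -b0.
Qed.

(** The value of [rho] is constant on the orbit, and going through [y] bounds it by the distance to
    [(y, y)]. *)
Lemma orbit_dist_diag P y : rho P.1 P.2 <= beta P (y, y).
Proof.
apply: orbit_dist_glb => P' /same_rho ->.
by rewrite /pdist /= (rhoC P'.2); exact: rhoT.
Qed.

Context (s : nat -> Y * Y) (s_off : forall i, (s i).1 <> (s i).2)
  (s_dense : forall P, P.1 <> P.2 -> forall t, 0 < t -> exists i, m0 (s i) P < t).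

(* By [r_off] the bumps vanish on the diagonal. *)
Section Bumps.
Context (r : nat -> R) (r_gt0 : forall i, 0 < r i) (r_le1 : forall i, r i <= 1)
  (r_off : forall i, r i <= Num.sqrt (rho (s i).1 (s i).2)).

(** * Bumps around orbits and their weighted sums *)

Definition bump i P := Num.max 0 (r i - Num.sqrt (beta (s i) P)).

Lemma bump_ge0 i P : 0 <= bump i P. Proof. by rewrite le_max lexx. Qed.
Lemma bump_le i P : bump i P <= r i.
Proof.
by rewrite ge_max (ltW (r_gt0 i)) /= gerBl sqrtr_ge0.
Qed.

Lemma bump_same i P Q : same P Q -> bump i P = bump i Q.
Proof. by move=> PQ; rewrite /bump (orbit_dist_same _ PQ). Qed.

Lemma bump_center i P : same (s i) P -> bump i P = r i.
Proof.
by move=> h; rewrite /bump orbit_dist_eq0// sqrtr0 subr0 (max_idPr _)// ltW.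
Qed.

Lemma bump_lip i P Q : `|bump i P - bump i Q| <= snow P Q.
Proof.
apply: (le_trans (max0_dist _ _)).
rewrite opprB addrC addrA addrNK distrC.
by apply: sqrt_dist (orbit_dist_lip _ _ _); exact: orbit_dist_ge0.
Qed.

Lemma bump_diag i y : bump i (y, y) = 0.
Proof.
apply: max_idPl; rewrite subr_le0 (le_trans (r_off i))// ler_sqrt.
  exact: orbit_dist_diag.
exact: orbit_dist_ge0.
Qed.

(** Off the orbit of the centre [beta] is positive and Lipschitz for [pdist], the square of [snow],
    so its root is flat; truncation at 0 does not enlarge increments. *)
Lemma bump_flat i P : ~ same (s i) P -> flat (bump i) P.
Proof.
move=> nP; apply: (@flat_dominated _ (fun Q => Num.sqrt (beta (s i) Q)) 1) => //.
  move=> Q; rewrite mul1r; apply: (le_trans (max0_dist _ _)).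
  by rewrite opprB addrC addrA addrNK distrC.
apply: flat_sqrt => [Q||Q]; first exact: orbit_dist_ge0.
  exact: orbit_dist_gt0.
exact: orbit_dist_lip.
Qed.

Definition weights (a : nat -> R) := forall i, 0 <= a i <= eps i.
Definition bumps (a : nat -> R) P := ssum (fun i => a i * bump i P).

Lemma bumps_term a P i : weights a -> `|a i * bump i P| <= 1 * eps i.
Proof.
move=> /(_ i) /andP[a0 a1]; rewrite ger0_norm ?mulr_ge0 ?bump_ge0// mulrC.
by rewrite ler_pM ?bump_ge0// (le_trans (bump_le i P)).
Qed.

Lemma bumps_bounded a P : weights a -> eps_bounded (fun i => a i * bump i P).
Proof. by move=> wa; exists 1 => i; exact: bumps_term. Qed.

Lemma bumps_diff a P Q i : weights a ->
  `|a i * bump i P - a i * bump i Q| <= snow P Q * eps i.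
Proof.
move=> /(_ i) /andP[a0 a1]; rewrite -mulrBr normrM ger0_norm// mulrC.
by rewrite ler_pM ?normr_ge0// bump_lip.
Qed.

Lemma bumps_ge0 a P : weights a -> 0 <= bumps a P.
Proof.
move=> wa; apply: ssum_ge0; first exact: bumps_bounded.
by move=> i; rewrite mulr_ge0 ?bump_ge0//; case/andP: (wa i).
Qed.

Lemma bumps_lip a P Q : weights a -> `|bumps a P - bumps a Q| <= snow P Q / 4.
Proof.
move=> wa; rewrite -ssumB; try exact: bumps_bounded.
by apply: ssum_le => i; exact: bumps_diff.
Qed.

Lemma bumps_same a P Q : same P Q -> bumps a P = bumps a Q.
Proof.
by move=> PQ; congr ssum; apply/funext => i; rewrite (bump_same _ PQ).
Qed.

Lemma bumps_diag a y : bumps a (y, y) = 0.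
Proof.
rewrite /bumps (_ : (fun i => _) = fun=> 0); first by rewrite (ssum1 (j := 0%N)).
by apply/funext => i; rewrite bump_diag mulr0.
Qed.

Lemma bumpsD a b P : weights a -> weights b ->
  bumps (fun i => a i + b i) P = bumps a P + bumps b P.
Proof.
move=> wa wb; rewrite /bumps -ssumD; try exact: bumps_bounded.
by congr ssum; apply/funext => i; rewrite mulrDl.
Qed.

(** A partial sum of flat bumps is flat, and the tail is Lipschitz for [snow] with constant
    [2 * eps N], made smaller than [e / 4]. *)
Lemma bumps_flat a P : weights a ->
  (forall i, a i <> 0 -> ~ same (s i) P) -> flat (bumps a) P.
Proof.
move=> wa na e e0.
have [N Ne] : exists N, @eps R N < e / 8 by apply: eps_small; lra.
have fl i : flat (fun Q => a i * bump i Q) P.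
  have [a0|/eqP /na ni] := eqVneq (a i) 0.
    rewrite (_ : (fun Q => _) = fun=> 0); first exact: flat_cst.
    by apply/funext => Q; rewrite a0 mul0r.
  apply: flat_dominated (bump_flat ni); last first.
    by move=> Q; rewrite -mulrBr normrM.
  exact: normr_ge0.
have e2 : 0 < e / 2 by lra.
have [t t0 tS] := flat_sum N fl e2.
exists t => // Q /tS h; rewrite -ssumB; try exact: bumps_bounded.
have := ssum_tail N (fun i => bumps_diff P Q i wa).
rewrite big_split/= sumrN; move: h; set x := (_ - \sum_(0 <= i < N) _).
set y := ssum _ => h1 h2; rewrite -(subrK x y) (le_trans (ler_normD _ _))//.
by have := snow_ge0 P Q; nra.
Qed.

(** * The square root metric perturbed by bumps *)

Definition bumped a (p q : Y) := Num.sqrt (rho p q) + bumps a (p, q).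

Lemma bumped_ge a p q : weights a -> Num.sqrt (rho p q) <= bumped a p q.
Proof. by move=> wa; rewrite lerDl bumps_ge0. Qed.

Lemma bumps_le a p q : weights a -> bumps a (p, q) <= Num.sqrt (rho p q) / 4.
Proof.
move=> wa; have := bumps_lip (p, q) (q, q) wa.
rewrite bumps_diag subr0 /snow /pdist /= rhoxx addr0.
exact: le_trans (ler_norm _).
Qed.

(** For the triangle inequality, moving one endpoint along the shorter leg changes [bumps] by at
    most a quarter of the root of that leg, while [sqrt_triangle] leaves half of it to spare. *)
Lemma bumped_metric a : weights a -> is_metric (bumped a).
Proof.
move=> wa; split.
- by move=> x; rewrite /bumped rhoxx sqrtr0 bumps_diag addr0.
- move=> x y xy; apply: rho0; have := bumped_ge x y wa; rewrite xy => h.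
  apply/eqP; rewrite eq_le rho_ge0 andbT.
  by rewrite -sqrtr_eq0 eq_le h sqrtr_ge0.
- by move=> x y; rewrite /bumped rhoC (bumps_same _ (same_swap x y)).
move=> y x z; rewrite /bumped.
have := bumps_lip (x, z) (x, y) wa; have := bumps_lip (x, z) (y, z) wa.
rewrite /snow /pdist /= !rhoxx addr0 add0r (rhoC z y) => h1 h2.
have := sqrt_triangle (rho_ge0 x y) (rho_ge0 y z) (rhoT y x z).
have := bumps_ge0 (x, y) wa; have := bumps_ge0 (y, z) wa.
move: (le_trans (ler_norm _) h1) (le_trans (ler_norm _) h2).
have := sqrtr_ge0 (rho x y); have := sqrtr_ge0 (rho y z).
move: h1 h2 => _ _; move: (Num.sqrt (rho x y)) (Num.sqrt (rho y z)) (Num.sqrt (rho x z)) => u v w.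
move: (bumps _ _) (bumps _ _) (bumps _ _) => ? ? ?.
by case: (leP u v) => _; lra.
Qed.

(** The sequence may meet an orbit repeatedly; only the first index of each orbit will be allowed a
    nonzero weight. *)
Definition fresh i := forall j, (j < i)%N -> ~ same (s j) (s i).
Definition isolated i :=
  exists2 t, 0 < t & forall Q, beta (s i) Q < t -> same (s i) Q.

Lemma fresh_rep i : exists2 j, fresh j & same (s j) (s i).
Proof.
have ex : exists j, `[< same (s j) (s i) >] by exists i; apply/asboolP.
case: (ex_minnP ex) => j /asboolP ji jmin; exists j => // k kj skj.
have : (j <= k)%N by apply/jmin/asboolP; exact: sameT ji.
by rewrite leqNgt kj.
Qed.

Lemma fresh_inj i j P : fresh i -> fresh j -> same (s i) P -> same (s j) P -> i = j.
Proof.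
move=> fi fj iP jP; have ij : same (s i) (s j) by exact: sameT (sameS jP).
by case: (ltngtP i j) => // [/fj|/fi] []//; exact: sameS.
Qed.

(* On isolated orbits, where no slope can be seen, the orbit is recognized by the
   value of the metric instead. *)
Section Rigidity.
Context (a : nat -> R) (wa : weights a)
  (a_old : forall i, ~ fresh i -> a i = 0)
  (a_steep : forall i, fresh i -> ~ isolated i -> a i = eps i)
  (r_isolated : forall i, isolated i ->
     forall Q, Num.sqrt (beta (s i) Q) < r i -> same (s i) Q)
  (a_isolated : forall i j, fresh i -> fresh j -> isolated i -> isolated j ->
     bumped a (s i).1 (s i).2 = bumped a (s j).1 (s j).2 -> i = j).

Local Notation d := (bumped a).
Local Notation md := (pdist d).
Let dP P := d P.1 P.2.

Lemma snow_le_bumped P Q : snow P Q <= md P Q.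
Proof.
apply: (@le_trans _ _ (Num.sqrt (rho P.1 Q.1) + Num.sqrt (rho P.2 Q.2))).
  rewrite -(@ler_pXn2r _ 2%N) ?nnegrE ?addr_ge0 ?sqrtr_ge0//.
  rewrite sqrrD !sqr_sqrtr ?pdist_ge0//.
  have : 0 <= Num.sqrt (rho P.1 Q.1) * Num.sqrt (rho P.2 Q.2).
    by rewrite mulr_ge0 ?sqrtr_ge0.
  rewrite /pdist mulr2n; lra.
by rewrite lerD// bumped_ge.
Qed.

Lemma bumped_le_snow P Q : md P Q <= 5 / 2 * snow P Q.
Proof.
have h1 : Num.sqrt (rho P.1 Q.1) <= snow P Q.
  by rewrite ler_sqrt ?pdist_ge0// lerDl.
have h2 : Num.sqrt (rho P.2 Q.2) <= snow P Q.
  by rewrite ler_sqrt ?pdist_ge0// lerDr.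
rewrite /pdist /bumped.
have := bumps_le P.1 Q.1 wa; have := bumps_le P.2 Q.2 wa; lra.
Qed.

Lemma bumped_same P Q : same P Q -> dP P = dP Q.
Proof.
move=> PQ; rewrite /dP /bumped (same_rho PQ) -!surjective_pairing.
by rewrite (bumps_same _ PQ).
Qed.

Lemma same_off P Q : P.1 <> P.2 -> same P Q -> Q.1 <> Q.2.
Proof. by move=> nP PQ e; apply/nP/rho0; rewrite (same_rho PQ) e. Qed.

Lemma bumped_flat b P : weights b -> P.1 <> P.2 ->
  (forall i, b i <> 0 -> ~ same (s i) P) ->
  flat (fun Q => bumped b Q.1 Q.2) P.
Proof.
move=> wb nP nb; apply: flatD; last first.
  by rewrite (_ : (fun Q => _) = bumps b); [exact: bumps_flat|];
    apply/funext => -[].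
apply: (flat_sqrt (h := fun Q => rho Q.1 Q.2)) => [Q||Q] //; last exact: rho_pdist.
by rewrite lt_neqAle rho_ge0 andbT; apply/eqP => /esym /rho0.
Qed.

(** Distinct fresh indices have distinct orbits and the others have weight zero, so every weighted
    bump except the [j]-th is flat at [P]. *)
Lemma bumped_split j P : fresh j -> same (s j) P -> P.1 <> P.2 ->
  exists2 F, flat F P & forall Q, dP Q = F Q + a j * bump j Q.
Proof.
move=> fj jP nP; pose b i := if i == j then 0 else a i.
pose c i := if i == j then a j else 0.
have wb : weights b.
  by move=> i; rewrite /b; case: ifP => _; rewrite ?wa// lexx ltW ?eps_gt0.
have wc : weights c.
  move=> i; rewrite /c; case: ifP => [/eqP ->|_]; first by rewrite wa.
  by rewrite lexx ltW ?eps_gt0.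
exists (fun Q => bumped b Q.1 Q.2).
  apply: bumped_flat => // i; rewrite /b; case: eqP => // ij ai0 iP.
  apply: ij; apply: fresh_inj iP jP => //.
  by apply: contrapT => /a_old.
move=> Q; rewrite /dP /bumped -!surjective_pairing -addrA; congr +%R.
rewrite (_ : a = fun i => b i + c i); last first.
  by apply/funext => i; rewrite /b /c; case: eqP => [->|_]; rewrite ?add0r ?addr0.
rewrite bumpsD//; congr +%R; rewrite {1}/bumps (ssum1 (j := j)) /c /b ?eqxx ?add0r//.
by move=> i /negPf ->; rewrite mul0r.
Qed.

(** Slopes are now measured against [md] instead of the comparable [snow], so that the notion
    depends on [d] alone and isometries preserve it. *)
Definition steep P c := forall t, 0 < t ->
  exists2 Q, 0 < md P Q < t & c * md P Q <= dP P - dP Q.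
Definition locally_cst P := exists2 t, 0 < t &
  forall Q, md P Q < t -> dP Q = dP P.

Lemma steepNcst P c : 0 < c -> steep P c -> ~ locally_cst P.
Proof.
move=> c0 sP [t t0 tP]; have [Q /andP[Q0 Qt]] := sP _ t0.
by rewrite (tP _ Qt) subrr leNgt mulr_gt0.
Qed.

Lemma isolated_cst j P : isolated j -> same (s j) P -> locally_cst P.
Proof.
move=> [t t0 tP] jP; exists (Num.sqrt t); first by rewrite sqrtr_gt0.
move=> Q Qt; apply/bumped_same/sameS/(sameT (sameS jP))/tP.
have h : m0 P Q < t by rewrite -ltr_sqrt// (le_lt_trans (snow_le_bumped P Q)).
have := orbit_dist_lip (s j) P Q; rewrite (orbit_dist_eq0 jP) sub0r normrN.
by move=> /(le_trans (ler_norm _)) /le_lt_trans; apply.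
Qed.

(** Upper bound for slopes: the flat part contributes nothing in the limit, and the [j]-th bump,
    being 1-Lipschitz, at most its weight. *)
Lemma steep_fresh P c : P.1 <> P.2 -> 0 < c -> steep P c ->
  exists j, [/\ fresh j, ~ isolated j, same (s j) P & c <= eps j].
Proof.
move=> nP c0 sP.
have [[j [fj jP]]|none] := pselect (exists j, fresh j /\ same (s j) P).
  have nj : ~ isolated j.
    by move=> ij; apply: (steepNcst c0 sP); exact: isolated_cst jP.
  exists j; split => //; rewrite leNgt; apply/negP => ec.
  have [F flF dF] := bumped_split fj jP nP.
  have ec2 : 0 < (c - eps j) / 2 by lra.
  have [t t0 tP] := flF _ ec2; have [Q /andP[Q0 Qt]] := sP _ t0.
  have le := snow_le_bumped P Q.
  have := tP Q (le_lt_trans le Qt); rewrite !dF => /(le_trans (ler_norm _)) h1.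
  have := le_trans (ler_norm _) (bump_lip j P Q) => h2.
  have := a_steep fj nj => ->; have := @eps_gt0 R j; move: h1 h2 ec2 ec le Q0.
  set e := eps j; set m := md P Q; set u := snow P Q.
  move=> h1 h2 ec2 ec le Q0 e0 h3.
  have : e * (bump j P - bump j Q) <= e * m by apply: ler_wpM2l; lra.
  have : (c - e) / 2 * u <= (c - e) / 2 * m by apply: ler_wpM2l; lra.
  have : 0 < (c - e) * m by apply: mulr_gt0; lra.
  by lra.
(* Without a weighted bump centred in the orbit of [P], the whole of [d] is flat there, against
   steepness. *)
have : flat dP P.
  apply: bumped_flat => // i ai iP; apply: none; exists i; split => //.
  by apply: contrapT => /a_old.
have c2 : 0 < c / 2 by lra.
move=> /(_ _ c2)[t t0 tP]; have [Q /andP[Q0 Qt]] := sP _ t0.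
have le := snow_le_bumped P Q.
have := tP Q (le_lt_trans le Qt) => /(le_trans (ler_norm _)) h1 h3.
have : c / 2 * snow P Q <= c / 2 * md P Q by apply: ler_wpM2l; lra.
have : 0 < c * md P Q by apply: mulr_gt0; lra.
lra.
Qed.

(** Lower bound for slopes: near [P] there are pairs off the orbit whose distance to the orbit is
    comparable to their distance to [P], and the bump drops by its root. *)
Lemma steep_center j P : fresh j -> ~ isolated j -> same (s j) P ->
  steep P (eps j / 6).
Proof.
move=> fj nj jP t t0; have nP := same_off (@s_off j) jP.
have [F flF dF] := bumped_split fj jP nP.
have e0 := @eps_gt0 R j.
have [|u u0 uP] := flF (eps j / 100); first by lra.
(* Below [v] the flat part is under control, [md] stays below [t] because [5 / 2 < 4], and the bump
   is not truncated. *)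
pose v := Num.min u (Num.min (t / 4) (r j)).
have v0 : 0 < v by rewrite !lt_min u0 r_gt0 divr_gt0.
have [Q bQ nQ] : exists2 Q, beta (s j) Q < v ^+ 2 / 2 & ~ same (s j) Q.
  apply: contrapT => H; apply: nj; exists (v ^+ 2 / 2).
    by rewrite divr_gt0 ?exprn_gt0.
  by move=> Q hQ; apply: contrapT => nQ; apply: H; exists Q.
have b0 := orbit_dist_gt0 nQ.
(* A pair of the orbit that realizes the distance up to the factor 2 is carried to [P], and [Q]
   along with it to [Q']. *)
have [|P' jP' P'Q] := @orbit_dist_lt (s j) Q (2 * beta (s j) Q); first by lra.
have [Q' QQ' e] := same_iso Q (sameT (sameS jP') jP).
rewrite (orbit_dist_same _ QQ') in bQ b0 P'Q; rewrite -e in P'Q.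
set B := beta (s j) Q' in bQ b0 P'Q.
have M2 : snow P Q' ^+ 2 < 2 * B by rewrite snow_sqr.
have M0 := snow_ge0 P Q'.
have BM : B <= snow P Q' ^+ 2 by rewrite snow_sqr orbit_dist_le.
have sB0 : 0 <= Num.sqrt B := sqrtr_ge0 B.
have sB2 : Num.sqrt B ^+ 2 = B by rewrite sqr_sqrtr// ltW.
have Mv : snow P Q' < v.
  by rewrite -(@ltr_pXn2r _ 2%N) ?nnegrE ?(ltW v0)//; lra.
have sBM : Num.sqrt B <= snow P Q' by rewrite -(@ler_pXn2r _ 2%N) ?nnegrE// sB2.
(* [7 / 10] is below the root of [1 / 2]. The slope becomes at least [(7 / 10 - 1 / 100) / (5 / 2)]
   times [eps j], which exceeds [eps j / 6]. *)
have MB : 7 / 10 * snow P Q' <= Num.sqrt B.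
  rewrite -(@ler_pXn2r _ 2%N) ?nnegrE//; last by lra.
  by rewrite sB2 exprMn [(7 / 10) ^+ 2]expr2; lra.
have M1 : 0 < snow P Q'.
  rewrite lt_neqAle M0 andbT; apply/eqP => h.
  by move: BM; rewrite -h expr0n /=; lra.
have := Mv; rewrite !lt_min => /and3P[Mu Mt Mr].
have le1 := snow_le_bumped P Q'; have le2 := bumped_le_snow P Q'.
exists Q'; first by apply/andP; split; lra.
rewrite !dF (a_steep fj nj) (bump_center jP).
have -> : bump j Q' = r j - Num.sqrt B.
  by rewrite /bump -/B (max_idPr _)// subr_ge0; lra.
have := uP _ Mu; rewrite ler_norml => /andP[h _].
have h1 : eps j * (7 / 10 * snow P Q') <= eps j * Num.sqrt B by rewrite ler_pM2l.
have h2 : eps j * md P Q' <= eps j * (5 / 2 * snow P Q') by rewrite ler_pM2l.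
have h3 : 0 < eps j * snow P Q' by exact: mulr_gt0.
rewrite mulrBr; lra.
Qed.

(** Pairs [s i] near [P] are locally constant too, hence not steep, hence in isolated orbits. All
    have the value of [P], so by [a_isolated] they form one orbit, and closedness puts [P] into
    it. *)
Lemma locally_cst_isolated P : P.1 <> P.2 -> locally_cst P ->
  exists j, [/\ fresh j, isolated j & same (s j) P].
Proof.
move=> nP [t t0 tP]; have [_ _ dC dT] := bumped_metric wa.
have near u : 0 < u -> exists i j, [/\ fresh j, isolated j, same (s j) (s i),
    m0 (s i) P < u & dP (s j) = dP P].
  (* If [snow] is below [t / 5], then [md] is below [t / 2], which leaves a ball of radius [t / 2]
     around [s i] on which [d] is constant. *)
  move=> u0; pose v := Num.min u ((t / 5) ^+ 2).
  have [|i] := s_dense nP (t := v).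
    by rewrite lt_min u0 exprn_gt0// divr_gt0.
  rewrite lt_min => /andP[iu iv].
  have iM : snow P (s i) < t / 5.
    rewrite -(@ltr_pXn2r _ 2%N) ?nnegrE ?snow_ge0//; last by lra.
    by rewrite snow_sqr pdistC.
  have it : md P (s i) < t / 2 by have := bumped_le_snow P (s i); lra.
  have [j fj ji] := fresh_rep i.
  have ci : locally_cst (s i).
    exists (t / 2); first by lra.
    move=> Q iQ; rewrite !tP; [by []|lra|].
    move: iQ it; rewrite /pdist; move: (dT (s i).1 P.1 Q.1) (dT (s i).2 P.2 Q.2).
    by do 6!move: (d _ _) => ?; lra.
  exists i, j; split => //; last by rewrite (bumped_same ji) tP//; lra.
  apply: contrapT => nj; apply: (steepNcst _ (steep_center fj nj ji)) => //.
  by have := @eps_gt0 R j; lra.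
have [i1 [j [fj ij _ _ dj]]] := near 1 ltr01.
exists j; split => //; apply: same_closed => u /near[i [k [fk ik ki iu dk]]].
exists (s i) => //; suff -> : j = k by [].
by apply: a_isolated => //; exact: etrans dj (esym dk).
Qed.

Let map2 (f : Y -> Y) P := (f P.1, f P.2).

Lemma steep_isometry f P c : isometries d f -> steep P c -> steep (map2 f P) c.
Proof.
move=> [_ fd] sP t /sP[Q Qt h]; exists (map2 f Q); first by rewrite /pdist /= !fd.
by rewrite /pdist /dP /= !fd.
Qed.

Lemma locally_cst_isometry f P :
  isometries d f -> locally_cst P -> locally_cst (map2 f P).
Proof.
move=> [[g fK gK] fd] [t t0 tP]; exists t => // -[p q].
have := tP (g p, g q).
by rewrite /pdist /dP /= -[d (g p) (g q)]fd -(fd P.1) -(fd P.2) !gK fd.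
Qed.

(** Orbits of the dense sequence are recognized by the value of [d] if isolated and by the slope
    otherwise; density and closedness extend this to all pairs off the diagonal. *)
Lemma isometry_same f P : isometries d f -> P.1 <> P.2 -> same P (map2 f P).
Proof.
move=> fI nP; have [[g fK gK] fd] := fI.
have gI : isometries d g.
  by split; [exists f|move=> p q; rewrite -(fd (g p)) !gK].
have foff Q : Q.1 <> Q.2 -> (map2 f Q).1 <> (map2 f Q).2.
  by move=> nQ /= /(can_inj fK).
have gf Q : map2 g (map2 f Q) = Q by case: Q => p q; rewrite /map2 /= !fK.
have center j Q : fresh j -> same (s j) Q -> same (s j) (map2 f Q).
  move=> fj jQ; have nQ := same_off (@s_off j) jQ.
  have [ij|nj] := pselect (isolated j).
    have /(locally_cst_isometry fI) := isolated_cst ij jQ.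
    move=> /(locally_cst_isolated (foff _ nQ))[k [fk ik kQ]].
    suff -> : j = k by [].
    apply: a_isolated => //; apply: etrans (bumped_same jQ) _.
    by apply: etrans (esym (bumped_same kQ)); rewrite /dP /= fd.
  have e6 k : 0 < eps k / 6 :> R by have := @eps_gt0 R k; lra.
  have /(steep_isometry fI) := steep_center fj nj jQ.
  move=> /(steep_fresh (foff _ nQ) (e6 j))[k [fk nk kQ /eps_geP kj]].
  (* The slope only gives [k <= j]; the inverse isometry yields the reverse inequality. *)
  have /(steep_isometry gI) := steep_center fk nk kQ; rewrite gf.
  move=> /(steep_fresh nQ (e6 k))[l [fl nl lQ /eps_geP lk]].
  have lj := fresh_inj fl fj lQ jQ; suff -> : j = k by [].
  by apply/eqP; rewrite eqn_leq kj andbT -lj.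
apply: same_closed => t t0.
(* An isometry of [d] enlarges [pdist] at most by the factor [(5 / 2) ^+ 2], so [t / 100] becomes
   less than [t / 2]. *)
have : 0 < Num.min (t / 2) (t / 100) by rewrite lt_min !divr_gt0.
move=> /(s_dense nP)[i]; rewrite lt_min => /andP[it1 it2].
have [j fj ji] := fresh_rep i.
have ii : same (s i) (map2 f (s i)) by apply: sameT (center _ _ fj ji); exact: sameS.
(* [R'] lies as close to the image of [s i] as [P] does to [s i], and the image of [P] is close to
   that same pair. *)
have [R' PR' e] := same_iso P ii; exists R' => //.
apply: le_lt_trans (pdistT (map2 f (s i)) _ _) _.
rewrite [m0 R' _]pdistC e.
suff : m0 (map2 f (s i)) (map2 f P) < t / 2 by lra.
rewrite -snow_sqr; have h1 := snow_le_bumped (map2 f (s i)) (map2 f P).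
have h2 := bumped_le_snow (s i) P.
have h3 : md (map2 f (s i)) (map2 f P) = md (s i) P by rewrite /pdist /= !fd.
have := snow_sqr (s i) P; have := snow_ge0 (s i) P.
have := snow_ge0 (map2 f (s i)) (map2 f P); rewrite h3 in h1.
move: (snow (map2 f (s i)) (map2 f P)) (snow (s i) P) h1 h2 => x y h1 h2 x0 y0 h4.
have xy : x <= 5 / 2 * y by lra.
have : x ^+ 2 <= (5 / 2 * y) ^+ 2 by rewrite ler_pXn2r ?nnegrE//; lra.
by rewrite exprMn h4 [(5 / 2) ^+ 2]expr2; lra.
Qed.

End Rigidity.
End Bumps.

(** The radii are fixed first, then the weights [a1] on non-isolated orbits, and last the weights
    [a2] on isolated ones. *)
Lemma rigid_metric : exists2 d : Y -> Y -> R, is_metric d &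
  [/\ forall p q, Num.sqrt (rho p q) <= d p q <= 5 / 4 * Num.sqrt (rho p q),
      forall P Q, same P Q -> d P.1 P.2 = d Q.1 Q.2 &
      forall f P, isometries d f -> P.1 <> P.2 -> same P (f P.1, f P.2)].
Proof.
have rho_off i : 0 < Num.sqrt (rho (s i).1 (s i).2).
  rewrite sqrtr_gt0 lt_neqAle rho_ge0 andbT; apply/eqP => /esym /rho0.
  exact: s_off.
(* At an isolated orbit the radius is so small that the bump is supported on the orbit itself. *)
have /choice[r rP] (i : nat) : exists x : R, [/\ 0 < x, x <= 1,
    x <= Num.sqrt (rho (s i).1 (s i).2) &
    isolated i -> forall Q, Num.sqrt (beta (s i) Q) < x -> same (s i) Q].
  have [[t t0 tP]|ni] := pselect (isolated i).
    exists (Num.min (Num.min 1 (Num.sqrt (rho (s i).1 (s i).2))) (Num.sqrt t)).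
    split.
    - by rewrite !lt_min ltr01 rho_off sqrtr_gt0.
    - by rewrite !ge_min lexx.
    - by rewrite !ge_min lexx orbT.
    - move=> _ Q; rewrite !lt_min => /andP[_]; rewrite ltr_sqrt//.
      exact: tP.
  exists (Num.min 1 (Num.sqrt (rho (s i).1 (s i).2))); split => //.
  - by rewrite lt_min ltr01 rho_off.
  - by rewrite ge_min lexx.
  - by rewrite ge_min lexx orbT.
have r_gt0 i : 0 < r i by case: (rP i).
have r_le1 i : r i <= 1 by case: (rP i).
have r_off i : r i <= Num.sqrt (rho (s i).1 (s i).2) by case: (rP i).
have r_isolated i : isolated i ->
    forall Q, Num.sqrt (beta (s i) Q) < r i -> same (s i) Q by case: (rP i).
pose a1 i : R := if `[< fresh i /\ ~ isolated i >] then eps i else 0.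
have wa1 : weights a1.
  by move=> i; rewrite /a1; case: ifP => _; rewrite ?lexx ltW ?eps_gt0.
(* The remaining weights are tuned against the values already fixed by [a1], so that the final
   distances are distinct. *)
have [c [cP cI]] := injective_values (fun i => bumped r a1 (s i).1 (s i).2) r_gt0.
pose a2 i : R := if `[< fresh i /\ isolated i >] then c i else 0.
have wa2 : weights a2.
  move=> i; rewrite /a2; case: ifP => _; last by rewrite lexx ltW ?eps_gt0.
  by have /andP[/ltW -> ->] := cP i.
pose a i := a1 i + a2 i.
have wa : weights a.
  move=> i; rewrite /a /a1 /a2; case: ifP => [/asboolP[_ ni]|_].
    by rewrite ifF ?addr0 ?lexx ?ltW ?eps_gt0//; apply/asboolP => -[].
  by rewrite add0r; exact: wa2.
have a_old i : ~ fresh i -> a i = 0.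
  by move=> nf; rewrite /a /a1 /a2 !ifF ?addr0//; apply/asboolP => -[].
have a_steep i : fresh i -> ~ isolated i -> a i = eps i.
  move=> fi ni; rewrite /a /a1 /a2 ifT ?ifF ?addr0//; first by apply/asboolP => -[].
  exact/asboolP.
(* The bumps of other isolated orbits vanish at [s i]; its own has full height [r i] there. *)
have value i : fresh i -> isolated i ->
    bumped r a (s i).1 (s i).2 = bumped r a1 (s i).1 (s i).2 + c i * r i.
  move=> fi ii; rewrite /bumped -!surjective_pairing bumpsD// addrA; congr +%R.
  rewrite /bumps (ssum1 (j := i)) => [|j ji].
    rewrite /a2 ifT; last by apply/asboolP.
    by rewrite bump_center//; exact: sameR.
  rewrite /a2; case: ifP => [/asboolP[fj ij]|_]; last by rewrite mul0r.
  suff -> : bump r j (s i) = 0 by rewrite mulr0.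
  apply: max_idPl; rewrite subr_le0 leNgt; apply/negP => /(r_isolated _ ij) ji'.
  by move/eqP: ji; apply; apply: fresh_inj ji' (sameR (s i)).
have a_isolated i j : fresh i -> fresh j -> isolated i -> isolated j ->
    bumped r a (s i).1 (s i).2 = bumped r a (s j).1 (s j).2 -> i = j.
  by move=> fi fj ii ij; rewrite !value//; exact: cI.
exists (bumped r a); first exact: bumped_metric.
split.
- move=> p q; rewrite bumped_ge//= /bumped.
  by have := bumps_le r_gt0 r_le1 r_off p q wa; lra.
- by move=> P Q PQ; exact: bumped_same PQ.
- by move=> f P; exact: isometry_same.
Qed.
End PairSystem.

(** * Metrics inducing a topology *)

Section MetricTopology.
Context {R : realType} {T : topologicalType}.
Implicit Types d : T -> T -> R.

Lemma nbhs_metric d x (A : set T) : induces_topology d ->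
  nbhs x A <-> exists2 e, 0 < e & forall y, d x y < e -> A y.
Proof.
by move=> di; rewrite di; split => -[e e0 eA]; exists e => // y; exact: eA.
Qed.

Lemma induces_topology_equiv d d' : induces_topology d ->
  (forall x e, 0 < e -> exists2 t, 0 < t & forall y, d x y < t -> d' x y < e) ->
  (forall x e, 0 < e -> exists2 t, 0 < t & forall y, d' x y < t -> d x y < e) ->
  induces_topology d'.
Proof.
move=> di dd' d'd x; rewrite di predeqE => A; split => -[e /= e0 eA].
  by have [t t0 tP] := d'd x e e0; exists t => // y /= /tP /eA.
by have [t t0 tP] := dd' x e e0; exists t => // y /= /tP /eA.
Qed.

Lemma closed_metric_ball d x r : is_metric d -> induces_topology d ->
  closed [set y | d x y <= r].
Proof.
move=> [_ _ dC dT] di y ycl; rewrite /= leNgt; apply/negP => rxy.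
have /ycl[z [/= xz yz]] : nbhs y [set z | d y z < d x y - r].
  by apply/nbhs_metric => //; exists (d x y - r) => //; lra.
by move: (dT z x y) xz yz; rewrite (dC z y); lra.
Qed.

Lemma proper_metric_le d d' : proper_metric d ->
  is_metric d' -> induces_topology d' ->
  (forall x r, exists r', forall y, d' x y <= r -> d x y <= r') ->
  proper_metric d'.
Proof.
move=> dp d'm d'i dd' x r; have [r' rr'] := dd' x r.
apply: subclosed_compact (dp x r') _; first exact: closed_metric_ball.
exact: rr'.
Qed.

End MetricTopology.

Lemma dense_seq {R : realType} {T : topologicalType} (d : T -> T -> R) (x0 : T) :
  is_metric d -> induces_topology d -> separable T ->
  exists s : nat -> T, forall x t, 0 < t -> exists i, d (s i) x < t.
Proof.
move=> [_ _ dC _] di [D /countable_injP[f fI] Dd].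
(* [s] inverts the injection [f] of [D] into the naturals, with default [x0] outside its image. *)
have /choice[s sP] n : exists x, (exists2 y, D y & f y = n) -> D x /\ f x = n.
  have [[y Dy fy]|H] := pselect (exists2 y, D y & f y = n); first by exists y.
  by exists x0.
exists s => x t t0; have xt : nbhs x [set y | d x y < t].
  by apply/nbhs_metric => //; exists t.
have [||y [/interior_subset /= xy Dy]] := Dd [set y | d x y < t]°.
- by exists x; exact: xt.
- exact: open_interior.
exists (f y); rewrite dC; suff -> : s (f y) = y by [].
have [Ds fs] : D (s (f y)) /\ f (s (f y)) = f y by apply: sP; exists y.
by apply: fI => //; rewrite inE.
Qed.

(** * Sums of metrics on products *)

Section ProductMetric.
Context {R : realType} {S T : topologicalType}.
Context (d : S -> S -> R) (e : T -> T -> R).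

Definition sum_dist (p q : S * T) := d p.1 q.1 + e p.2 q.2.

Lemma sum_dist_metric : is_metric d -> is_metric e -> is_metric sum_dist.
Proof.
move=> dm em; have [d0 d1 dC dT] := dm; have [e0 e1 eC eT] := em.
split; rewrite /sum_dist.
- by move=> p; rewrite d0 e0 addr0.
- move=> [p p'] [q q'] /= h.
  have := metric_ge0 p q dm; have := metric_ge0 p' q' em => h1 h2.
  by congr pair; [apply: d1|apply: e1]; lra.
- by move=> p q; rewrite dC eC.
- by move=> q p r; have := dT q.1 p.1 r.1; have := eT q.2 p.2 r.2; lra.
Qed.

Lemma sum_dist_induces : is_metric d -> is_metric e ->
  induces_topology d -> induces_topology e -> induces_topology sum_dist.
Proof.
move=> dm em di ei [x y]; rewrite predeqE => A; split.
  move=> [[B C] [/= /nbhs_metric - /(_ R d di)[t t0 tB]]].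
  move=> /nbhs_metric - /(_ R e ei)[u u0 uC] BCA.
  exists (Num.min t u); first by rewrite /= lt_min t0.
  move=> [x' y']; rewrite /= /sum_dist /= lt_min => /andP[h1 h2].
  have := metric_ge0 x x' dm; have := metric_ge0 y y' em => h3 h4.
  by apply: BCA; split => /=; [apply: tB|apply: uC]; lra.
move=> [t /= t0 tA]; have t2 : 0 < t / 2 by lra.
exists ([set x' | d x x' < t / 2], [set y' | e y y' < t / 2]).
  by split; apply/nbhs_metric => //=; exists (t / 2).
move=> [x' y'] [/= h1 h2]; apply: tA; rewrite /= /sum_dist /=; lra.
Qed.

Lemma sum_dist_proper : Metr_c R S d -> Metr_c R T e ->
  Metr_c R (S * T)%type sum_dist.
Proof.
move=> [dm di dp] [em ei ep].
have sm := sum_dist_metric dm em; have si := sum_dist_induces dm em di ei.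
split => // -[x y] r.
apply: subclosed_compact (compact_setX (dp x r) (ep y r)) _.
  exact: closed_metric_ball.
move=> [x' y']; rewrite /= /sum_dist /=.
by have := metric_ge0 x x' dm; have := metric_ge0 y y' em; split => /=; lra.
Qed.

End ProductMetric.

(** * Pairs of points up to translation and swap *)

Section Translations.
Context {R : realType} {G : topologicalGroupType} {X : topologicalType}.
Implicit Types (p q : G * X) (P Q : (G * X) * (G * X)).

Definition translate (a : G) p : G * X := ((a * p.1)%g, p.2).

(** The swap is allowed because a symmetric distance cannot tell the order of a pair. *)
Definition same_pair P Q := exists a : G,
  Q = (translate a P.1, translate a P.2) \/ Q = (translate a P.2, translate a P.1).

Lemma translate1 p : translate 1%g p = p.
Proof. by case: p => g x; rewrite /translate mul1g. Qed.

Lemma translateM a b p : translate (a * b)%g p = translate a (translate b p).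
Proof. by rewrite /translate /= mulgA. Qed.

Lemma translateK a : cancel (translate a) (translate a^-1%g).
Proof. by move=> p; rewrite -translateM mulVg translate1. Qed.

Lemma same_pair_refl P : same_pair P P.
Proof. by exists 1%g; left; rewrite !translate1; case: P. Qed.

Lemma same_pair_sym P Q : same_pair P Q -> same_pair Q P.
Proof.
case: P => p q [a [] ->]; exists a^-1%g; [left|right]; by rewrite /= !translateK.
Qed.

Lemma same_pair_trans Q P S : same_pair P Q -> same_pair Q S -> same_pair P S.
Proof.
by move=> [a [] ->] [b [] ->] /=; exists (b * a)%g;
  rewrite !translateM; [left|right|right|left].
Qed.

Lemma same_pair_swap p q : same_pair (p, q) (q, p).
Proof. by exists 1%g; right; rewrite !translate1. Qed.

(** First the [X]-coordinate is shown to be preserved. Then two points with different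
    [X]-coordinates cannot be swapped, so one translation moves both. *)
Lemma translation_of_pairs (f : G * X -> G * X) :
  (exists x y : X, x <> y) ->
  ~ ([set: G] #= `I_1 /\ [set: X] #= `I_2)%card ->
  (forall P, P.1 <> P.2 -> same_pair P (f P.1, f P.2)) ->
  exists a, f = translate a.
Proof.
move=> [x0 [y0 xy0]] card fP.
have f2 p : (f p).2 = p.2.
  case: p => g x; have [[c c1]|G1] := pselect (exists c : G, c <> 1%g).
    (* Both points lie over [x], so their images do so whether swapped or not. *)
    have /fP[a] : ((g, x), ((g * c)%g, x)).1 <> ((g, x), ((g * c)%g, x)).2.
      move=> /= [] /esym e; apply: c1; apply: (mulgI g).
      by rewrite e mulg1.
    by rewrite /translate /= => -[[-> _]|[-> _]].
  (* Here [G] is trivial, so [X] has a third point; the pairs formed by [x] with [y] and with [z]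
     cannot both be swapped. *)
  have [y [z [xy xz yz]]] : exists y z : X, [/\ x <> y, x <> z & y <> z].
    apply: contrapT => H; apply: card; split.
      rewrite (_ : [set: G] = [set 1%g]) ?card_set1//.
      apply/seteqP; split => // c _ /=; apply: contrapT => c1.
      by apply: G1; exists c.
    have [y xy] : exists y, x <> y.
      have [<-|/eqP] := eqVneq x0 x; first by exists y0.
      by move=> /nesym; exists x0.
    have xyP z : z = x \/ z = y.
      apply: contrapT => /not_orP[/nesym xz /nesym yz].
      by apply: H; exists y, z.
    apply/card_set_bijP; exists (fun z => (z != x) : nat); split.
    - by move=> z _ /=; case: (z == x).
    - move=> z w _ _ /=; have [->|->] := xyP z; have [->|->] := xyP w => //;
        by rewrite eqxx (introF eqP (nesym xy)).
    - case=> [|[|//]] _ /=; first by exists x; rewrite ?eqxx.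
      by exists y => //; rewrite (introF eqP (nesym xy)).
  have G0 (c : G) : c = 1%g by apply: contrapT => c1; apply: G1; exists c.
  have /fP[a] : ((g, x), (g, y)).1 <> ((g, x), (g, y)).2 by move=> [].
  have /fP[b] : ((g, x), (g, z)).1 <> ((g, x), (g, z)).2 by move=> [].
  by rewrite /translate /= => -[[-> _]|[-> _]]// [[_ ->]|[_ /esym/yz]].
(* The quotient [(f p).1 * p.1^-1] is the group element by which [f] translates [p]. *)
have fpq p q : p.2 <> q.2 -> ((f p).1 * p.1^-1 = (f q).1 * q.1^-1)%g.
  move=> pq; have /fP[a [[]|[]]] /= : (p, q).1 <> (p, q).2.
  - by move=> /= e; apply: pq; rewrite e.
  - by move=> -> -> /=; rewrite !mulgK.
  - by move=> e; have := f2 p; rewrite e /= => /esym.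
exists (f (1%g, x0)).1; apply/funext => p.
suff e : ((f (1%g, x0)).1 = (f p).1 * p.1^-1)%g.
  by rewrite /translate e mulgVK -(f2 p) -surjective_pairing.
(* A point over [x0] is compared with [(1, x0)] by way of [(1, y0)]. *)
have [e|/eqP px] := eqVneq p.2 x0.
  have -> : ((f p).1 * p.1^-1 = (f (1%g, y0)).1 * (1%g, y0).1^-1)%g.
    by apply: fpq; rewrite e.
  rewrite -[LHS]mulg1 -[X in (_ * X)%g = _]invg1.
  exact: (fpq (1%g, x0) (1%g, y0)).
rewrite -[LHS]mulg1 -[X in (_ * X)%g = _]invg1.
by apply: (fpq (1%g, x0)) => /esym.
Qed.

End Translations.

(** * The isometry group of the product *)

Section IsometryGroup.
Context {R : realType} {G : topologicalGroupType} {X : topologicalType}.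
Context (dG : G -> G -> R) (dX : X -> X -> R).
Context (dG_proper : Metr_c R G dG) (dX_proper : Metr_c R X dX)
  (dG_inv : forall a g h, dG (a * g)%g (a * h)%g = dG g h).

Local Notation rho := (sum_dist dG dX).

Let dGm : is_metric dG. Proof. by case: dG_proper. Qed.
Let dXm : is_metric dX. Proof. by case: dX_proper. Qed.
Let dGi : induces_topology dG. Proof. by case: dG_proper. Qed.
Let dXi : induces_topology dX. Proof. by case: dX_proper. Qed.
Let rho_metric : is_metric rho. Proof. exact: sum_dist_metric. Qed.

Lemma sum_dist_translate a p q : rho (translate a p) (translate a q) = rho p q.
Proof. by rewrite /sum_dist /= dG_inv. Qed.

Lemma same_pair_rho (P Q : (G * X) * (G * X)) :
  same_pair P Q -> rho P.1 P.2 = rho Q.1 Q.2.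
Proof.
have [_ _ rC _] := rho_metric.
by move=> [a [->|->]] /=; rewrite sum_dist_translate// rC.
Qed.

Lemma same_pair_iso (P P' Q : (G * X) * (G * X)) : same_pair P P' ->
  exists2 Q', same_pair Q Q' & pdist rho P' Q' = pdist rho P Q.
Proof.
move=> [a [->|->]].
  exists (translate a Q.1, translate a Q.2); first by exists a; left.
  by rewrite /pdist /= !sum_dist_translate.
exists (translate a Q.2, translate a Q.1); first by exists a; right.
by rewrite /pdist /= !sum_dist_translate addrC.
Qed.

(** The approximating [a] cancels in the quotient of the two group coordinates, so by continuity
    [g'^-1 * h' = g^-1 * h]; hence [g' * g^-1] moves both points exactly. *)
Lemma translate_closed (p q p' q' : G * X) :
  (forall t, 0 < t -> exists a,
     rho (translate a p) p' + rho (translate a q) q' < t) ->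
  exists a, p' = translate a p /\ q' = translate a q.
Proof.
move: p q p' q' => [g x] [h y] [g' x'] [h' y'] H.
have [_ G1 GC _] := dGm; have [_ X1 _ _] := dXm.
have small t : 0 < t -> exists a, [/\ dG (a * g)%g g' < t, dX x x' < t,
    dG (a * h)%g h' < t & dX y y' < t].
  move=> /H[a]; rewrite /sum_dist /= => h1; exists a.
  have := metric_ge0 (a * g)%g g' dGm; have := metric_ge0 (a * h)%g h' dGm.
  by have := metric_ge0 x x' dXm; have := metric_ge0 y y' dXm; split; lra.
have eqX z z' : (forall t, 0 < t -> dX z z' < t) -> z = z'.
  move=> zz; apply: X1; apply/eqP; rewrite eq_le metric_ge0// andbT.
  by rewrite leNgt; apply/negP => /zz; rewrite ltxx.
have -> : x' = x by apply/esym/eqX => t /small[a []].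
have -> : y' = y by apply/esym/eqX => t /small[a []].
have e : (g'^-1 * h' = g^-1 * h)%g.
  apply: G1; apply/eqP; rewrite eq_le metric_ge0// andbT leNgt; apply/negP.
  set e := dG _ _ => e0.
  have c : {for (g', h'), continuous (fun u : G * G => (u.1^-1 * u.2)%g)}.
    apply: (@continuous2_cvg _ _ _ _ _ _ (fun u : G * G => (u.1^-1)%g) snd
      (fun u v : G => (u * v)%g)).
    - exact: (mulg_continuous (g'^-1%g, h')).
    - apply: (@continuous_comp _ _ _ fst (fun u : G => (u^-1)%g)).
        exact: cvg_fst.
      exact: invg_continuous.
    - exact: cvg_snd.
  have /c : nbhs (g'^-1 * h')%g [set z | dG (g'^-1 * h')%g z < e].
    by apply/nbhs_metric => //; exists e.
  move=> [[B C] [/= /nbhs_metric - /(_ R dG dGi)[t t0 tB]]].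
  move=> /nbhs_metric - /(_ R dG dGi)[u u0 uC] BC.
  have [|a [ag _ ah _]] := small (Num.min t u); first by rewrite lt_min t0.
  move: ag ah; rewrite !lt_min ![dG (a * _)%g _]GC => /andP[ag _] /andP[_ ah].
  have /BC : (B `*` C) ((a * g)%g, (a * h)%g) by split; [exact: tB|exact: uC].
  by rewrite /= invgM mulgA mulgVK ltxx.
exists (g' * g^-1)%g; rewrite /translate /= mulgVK -mulgA -e.
by rewrite mulgA mulgV mul1g.
Qed.

Lemma same_pair_closed (P Q : (G * X) * (G * X)) :
  (forall t, 0 < t -> exists2 P', same_pair P P' & pdist rho P' Q < t) ->
  same_pair P Q.
Proof.
case: Q => p' q' H.
(* Either unswapped approximations exist at every scale, or below some scale [u] all are swapped. *)
have [H1|] := pselect (forall t, 0 < t -> exists a,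
    rho (translate a P.1) p' + rho (translate a P.2) q' < t).
  by have [a [-> ->]] := translate_closed H1; exists a; left.
move=> /existsNP[u /not_implyP[u0 uP]].
have [|a [-> ->]] := @translate_closed P.2 P.1 p' q'; last by exists a; right.
move=> t t0; have [|P' [a aP]] := H (Num.min t u); first by rewrite lt_min t0.
rewrite lt_min => /andP[h1 h2].
case: aP h1 h2 => -> h1 h2; last by exists a.
by exfalso; apply: uP; exists a.
Qed.

Lemma dense_pairs : separable G -> separable X -> (exists x y : X, x <> y) ->
  exists s : nat -> (G * X) * (G * X), (forall i, (s i).1 <> (s i).2) /\
  forall P, P.1 <> P.2 -> forall t, 0 < t -> exists i, pdist rho (s i) P < t.
Proof.
move=> Gs Xs [x0 [y0 xy0]].
have [sG sGP] := dense_seq 1%g dGm dGi Gs.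
have [sX sXP] := dense_seq x0 dXm dXi Xs.
pose S (n : (nat * nat) * (nat * nat)) :=
  ((sG n.1.1, sX n.1.2), (sG n.2.1, sX n.2.2)).
pose P0 : (G * X) * (G * X) := ((1%g, x0), (1%g, y0)).
pose ok (P : (G * X) * (G * X)) := if P.1 == P.2 then P0 else P.
exists (fun i => ok (if unpickle i is Some n then S n else P0)); split.
  move=> i; rewrite /ok; case: ifPn => [_ []//|/eqP]; exact.
move=> P nP t t0; have := metric_ge0 P.1 P.2 rho_metric.
rewrite le_eqVlt => /orP[/eqP/esym r0|r0].
  by case: rho_metric => _ /(_ _ _ r0).
(* There are four coordinates to approximate. Staying below [rho P.1 P.2] keeps the approximating
   pair off the diagonal, so that [ok] does not replace it by [P0]. *)
have m0 : 0 < Num.min t (rho P.1 P.2) / 4 by rewrite divr_gt0// lt_min t0.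
have [i iP] := sGP P.1.1 _ m0; have [j jP] := sXP P.1.2 _ m0.
have [k kP] := sGP P.2.1 _ m0; have [l lP] := sXP P.2.2 _ m0.
exists (pickle ((i, j), (k, l))); rewrite pickleK.
have h : pdist rho (S (i, j, (k, l))) P < Num.min t (rho P.1 P.2).
  by rewrite /pdist /sum_dist /=; lra.
rewrite /ok ifF; first by move: h; rewrite lt_min => /andP[].
apply/negP => /eqP e; move: h; rewrite lt_min => /andP[_].
have := rho_pdist rho_metric (S (i, j, (k, l))) P.
rewrite e; have [-> _ _ _] := rho_metric; rewrite sub0r normrN.
by move=> /(le_trans (ler_norm _)); lra.
Qed.

(** The metric lies between [sqrt rho] and [5 / 4 * sqrt rho], which transfers the topology and
    properness from [rho]. *)
Lemma rigid_sum_dist : separable G -> separable X -> (exists x y : X, x <> y) ->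
  ~ ([set: G] #= `I_1 /\ [set: X] #= `I_2)%card ->
  exists2 d : G * X -> G * X -> R, Metr_c R (G * X)%type d &
    isometries d = [set f | exists a : G, f = translate a].
Proof.
move=> Gs Xs X_gt1 card; have [s [s_off s_dense]] := dense_pairs Gs Xs X_gt1.
have [d dm [dle dsame dI]] := rigid_metric rho_metric same_pair_refl
  same_pair_sym same_pair_trans same_pair_swap same_pair_iso same_pair_closed
  same_pair_rho s_off s_dense.
have [_ rhoi rhop] := sum_dist_proper dG_proper dX_proper.
have di : induces_topology d.
  apply: (induces_topology_equiv rhoi) => p e e0.
    exists ((e / 2) ^+ 2); first by rewrite exprn_gt0// divr_gt0.
    move=> q h; have /andP[_ /le_lt_trans] := dle p q; apply.
    have : Num.sqrt (rho p q) < e / 2; last by lra.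
    have e2 : 0 <= e / 2 by lra.
    by rewrite -[e / 2]ger0_norm// -sqrtr_sqr ltr_sqrt// exprn_gt0// divr_gt0.
  exists (Num.sqrt e); first by rewrite sqrtr_gt0.
  by move=> q h; have /andP[/le_lt_trans /(_ h)] := dle p q; rewrite ltr_sqrt.
exists d; first split => //.
  apply: (proper_metric_le rhop) => // p r; exists (r ^+ 2) => q h.
  have /andP[h1 _] := dle p q; have r0 : 0 <= r.
    exact: le_trans (sqrtr_ge0 _) (le_trans h1 h).
  rewrite -(sqr_sqrtr (metric_ge0 p q rho_metric)) ler_pXn2r ?nnegrE ?sqrtr_ge0//.
  exact: le_trans h1 h.
apply/seteqP; split => f.
  by move=> fI; apply: translation_of_pairs => // P; exact: dI.
move=> [a ->]; split; first by exists (translate a^-1%g); first exact: translateK;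
  move=> p; rewrite -translateM mulgV translate1.
by move=> p q; apply/esym/(dsame (p, q) (translate a p, translate a q)); exists a; left.
Qed.

End IsometryGroup.

(** * Free action and topological isomorphism *)

Section TranslationIsometries.
Context {R : realType} {G : topologicalGroupType} {X : topologicalType}.
Context (d : G * X -> G * X -> R) (x0 : X)
  (dI : isometries d = [set f | exists a : G, f = translate a]).

Lemma translations_act_freely : iso_acts_freely d.
Proof.
move=> f [[g x] fp]; have := iso_funP f; rewrite dI => -[a fa].
apply: iso_inj => q; rewrite fa in fp *; case: fp => /(canRL (mulgK _)).
by rewrite mulgV => ->; rewrite translate1.
Qed.

Lemma translate_isometry a : isometries d (translate a).
Proof. by rewrite dI; exists a. Qed.

Lemma translations_isomorphic : topgroup_isomorphic (Iso d) G.
Proof.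
(* Evaluation at the base point [(1, x0)] reads off the translating element, and it is continuous
   for pointwise convergence. *)
pose phi (f : Iso d) : G := (iso_fun f (1%g, x0)).1.
pose psi (a : G) : Iso d := mk_iso (translate_isometry a).
have phiE f : iso_fun f = translate (phi f).
  have := iso_funP f; rewrite dI => -[a fa].
  by rewrite /phi fa /translate /= mulg1.
exists phi, psi; split.
- move=> f h; rewrite {1}/phi (_ : iso_fun _ = iso_fun f \o iso_fun h)//=.
  by rewrite phiE [iso_fun h]phiE /= mulg1.
- by move=> f; apply: iso_inj => p; rewrite [iso_fun f]phiE.
- by move=> a; rewrite /phi /= mulg1.
- have h1 : continuous (set_val : Iso d -> {ptws (G * X)%type -> (G * X)%type}).
    exact: initial_continuous.
  have h2 := @proj_continuous (G * X)%type (fun=> (G * X)%type) (1%g, x0).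
  move=> f; have h3 := continuous_comp (h1 f) (h2 _).
  exact: (continuous_comp h3 cvg_fst).
(* Continuity into the pointwise topology is checked at one point [p] at a time, where it is that of
   the multiplication. *)
apply: continuous_comp_initial => a; apply/cvg_sup => p.
move=> U [V [[W oW <-] /= Wa] WU].
apply: filterS WU _; rewrite /=.
have ca : (fun b : G => translate b p) @ a --> translate a p.
  have h1 : (fun b : G => (b, p.1)) @ a --> (a, p.1).
    by apply: cvg_pair; [exact: cvg_id|exact: cvg_cst].
  have h2 : (fun b : G => (b * p.1)%g) @ a --> (a * p.1)%g.
    exact: cvg_comp h1 (mulg_continuous (a, p.1)).
  by apply: cvg_pair; [exact: h2|exact: cvg_cst].
by apply: ca; exact: open_nbhs_nbhs.
Qed.

End TranslationIsometries.

(** * Proper left-invariant metrics on groups *)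

Section ChainLength.
Context {R : realType} {G : groupType} (W : R -> set G).
Context (W1 : forall t, 0 < t -> W t 1%g)
  (W_mono : forall t u, t <= u -> W t `<=` W u)
  (W3 : forall t x y z, 0 < t -> W t x -> W t y -> W t z -> W (2 * t) (x * y * z)%g)
  (W_cover : forall g, exists2 t, 0 < t & W t g)
  (W_sep : forall g, (forall t, 0 < t -> W t g) -> g = 1%g).

Implicit Types (c : seq (G * R)) (g h : G).

(** A link is a group element with a radius [t]; [W t] stands for a rough ball of radius [t] around
    1, controlled by [W3] only up to the factor 2. *)
Definition chain c := all (fun p => `[< 0 < p.2 /\ W p.2 p.1 >]) c.
Definition chain_prod c : G := foldr (fun p g => (p.1 * g)%g) 1%g c.
Definition chain_cost c : R := \sum_(p <- c) p.2.

Lemma chain_prod_cat c c' :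
  chain_prod (c ++ c') = (chain_prod c * chain_prod c')%g.
Proof. by elim: c => [|p c IH] /=; rewrite ?mul1g// IH mulgA. Qed.

Lemma chain_cost_ge0 c : chain c -> 0 <= chain_cost c.
Proof.
elim: c => [|p c IH]; first by rewrite /chain_cost big_nil.
rewrite /= /chain_cost big_cons => /andP[/asboolP[p0 _] /IH].
by rewrite -/(chain_cost c); lra.
Qed.

(** Links are collected greedily: [p] is the first one to push the cost above [a], or else the last
    link. *)
Lemma chain_split p0 c a b : chain (p0 :: c) -> 0 <= a -> 0 <= b ->
  chain_cost (p0 :: c) <= a + b -> exists c1 p c2,
  [/\ p0 :: c = c1 ++ p :: c2, chain_cost c1 <= a & chain_cost c2 <= b].
Proof.
rewrite /chain_cost; elim: c p0 a => [|q c IH] p0 a ch a0 b0 le.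
  by exists [::], p0, [::]; rewrite big_nil.
case: (leP p0.2 a) => pa; last first.
  exists [::], p0, (q :: c); rewrite big_nil; split => //.
  by move: le; rewrite big_cons; lra.
have [||||c1 [p [c2 [e h1 h2]]]] := IH q (a - p0.2).
- by case/andP: ch.
- by lra.
- by [].
- by move: le; rewrite big_cons; lra.
exists (p0 :: c1), p, c2; split => //; first by rewrite e.
by rewrite big_cons; lra.
Qed.

(* Cut the chain into two pieces of at most half the cost around one link. *)
Lemma chain_prod_in c t : chain c -> 0 < t -> chain_cost c <= t ->
  W (2 * t) (chain_prod c).
Proof.
have [n] := ubnP (size c); elim: n => // n IH in c t *.
case: c => [|p0 c] sc ch t0 le; first by apply: W1; lra.
have t2 : 0 <= t / 2 by lra.
have [|c1 [p [c2 [e h1 h2]]]] := chain_split ch t2 t2; first by rewrite -splitr.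
have := ch; rewrite e /chain all_cat /= => /and3P[ch1 /asboolP[p0' Wp] ch2].
have le' := le; rewrite e /chain_cost big_cat /= big_cons in le'.
rewrite chain_prod_cat /= mulgA.
have t2' : 0 < t / 2 by lra.
have tE : t = 2 * (t / 2) by lra.
move: sc; rewrite e size_cat /= addnS ltnS => sc.
(* By induction at [t / 2] both outer products lie in [W t], as does the middle link, whose cost is
   at most [t]. *)
apply: W3 => //.
- by rewrite tE; apply: IH => //; exact: leq_ltn_trans (leq_addr _ _) sc.
- apply: W_mono Wp; move: (chain_cost_ge0 ch1) (chain_cost_ge0 ch2).
  by rewrite /chain_cost; lra.
- by rewrite tE; apply: IH => //; exact: leq_ltn_trans (leq_addl _ _) sc.
Qed.

Definition chain_length g : R :=
  inf [set chain_cost c | c in [set c | chain c /\ chain_prod c = g]].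
Local Notation len := chain_length.

Let costs g := [set chain_cost c | c in [set c | chain c /\ chain_prod c = g]].

Let chain1 g t : 0 < t -> W t g -> costs g t.
Proof.
move=> t0 Wt; exists [:: (g, t)]; last by rewrite /chain_cost big_seq1.
by rewrite /chain /= mulg1 andbT; split => //; exact/asboolP.
Qed.

Let costs_has_inf g : has_inf (costs g).
Proof.
split; first by have [t t0 tg] := W_cover g; exists t; exact: chain1.
by exists 0 => _ [c [/chain_cost_ge0 ch _] <-].
Qed.

Lemma chain_length_ge0 g : 0 <= len g.
Proof.
apply: lb_le_inf; first by case: (costs_has_inf g).
by move=> _ [c [/chain_cost_ge0 ch _] <-].
Qed.

Lemma chain_length_le g t : 0 < t -> W t g -> len g <= t.
Proof.
move=> t0 /(chain1 t0); apply: ge_inf; by case: (costs_has_inf g).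
Qed.

(** With [chain_length_le] this compares the balls of the length with the sets [W] up to the factor
    2. *)
Lemma chain_length_lt g t : len g < t -> W (2 * t) g.
Proof.
move=> lt; have t0 := le_lt_trans (chain_length_ge0 g) lt.
have [_ [c [ch <-] <-] /ltW ct] := inf_lt (proj1 (costs_has_inf g)) lt.
exact: chain_prod_in.
Qed.

Lemma chain_lengthM g h : len (g * h)%g <= len g + len h.
Proof.
apply/ler_addgt0Pr => e e0; have e2 : 0 < e / 2 by lra.
have [_ [c [cc cg] <-] ce] := inf_adherent e2 (costs_has_inf g).
have [_ [c' [cc' ch] <-] ce'] := inf_adherent e2 (costs_has_inf h).
have : len (g * h)%g <= chain_cost c + chain_cost c'.
  apply: ge_inf; first by case: (costs_has_inf (g * h)%g).
  exists (c ++ c'); last by rewrite /chain_cost big_cat.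
  split; last by rewrite chain_prod_cat cg ch.
  by rewrite /chain all_cat; apply/andP.
by move: ce ce'; rewrite /chain_length -/(costs g) -/(costs h); lra.
Qed.

Lemma chain_length1 : len 1%g = 0.
Proof.
apply/eqP; rewrite eq_le chain_length_ge0 andbT.
by apply/ler_addgt0Pr => e e0; rewrite add0r; apply: chain_length_le => //; exact: W1.
Qed.

Lemma chain_length_eq0 g : len g = 0 -> g = 1%g.
Proof.
move=> g0; apply: W_sep => t t0; rewrite (_ : t = 2 * (t / 2)); last by lra.
by apply: chain_length_lt; rewrite g0; lra.
Qed.

(** The maximum symmetrizes the length; both quotients are invariant under left translation. *)
Definition chain_dist g h : R := Num.max (len (g^-1 * h)%g) (len (h^-1 * g)%g).

Lemma chain_dist_metric : is_metric chain_dist.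
Proof.
split.
- by move=> g; rewrite /chain_dist mulVg chain_length1 maxxx.
- move=> g h e; have /chain_length_eq0 : len (g^-1 * h)%g = 0.
    apply/eqP; rewrite eq_le chain_length_ge0 andbT -e /chain_dist.
    by rewrite le_max lexx.
  by move=> /(canRL (mulVKg _)); rewrite mulg1.
- by move=> g h; rewrite /chain_dist maxC.
have H y x z : len (x^-1 * z)%g <= len (x^-1 * y)%g + len (y^-1 * z)%g.
  by rewrite -{1}(mulVKg y z) mulgA; exact: chain_lengthM.
move=> y x z; rewrite /chain_dist ge_max; apply/andP; split.
  apply: (le_trans (H y x z)); apply: lerD; by rewrite le_max lexx.
apply: (le_trans (H y z x)); rewrite addrC.
by apply: lerD; rewrite le_max lexx orbT.
Qed.

Lemma chain_dist_inv a g h : chain_dist (a * g)%g (a * h)%g = chain_dist g h.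
Proof. by rewrite /chain_dist !invgM -!mulgA !mulKg. Qed.

End ChainLength.

(** * Compact sets and neighborhoods of the identity in a group *)

Section GroupNeighborhoods.
Context {G : topologicalGroupType}.
Implicit Types (g : G) (U V : set G).

Definition mul3 U V V' : set G :=
  [set (p.1.1 * p.1.2 * p.2)%g | p in (U `*` V) `*` V'].

Lemma mul3I U x y z : U x -> U y -> U z -> mul3 U U U (x * y * z)%g.
Proof. by move=> Ux Uy Uz; exists ((x, y), z). Qed.

Lemma mulg_continuous_l g : continuous (fun y : G => (g * y)%g).
Proof.
move=> y; have h1 : (fun z : G => (g, z)) @ y --> (g, y).
  by apply: cvg_pair; [exact: cvg_cst|exact: cvg_id].
exact: cvg_comp h1 (mulg_continuous (g, y)).
Qed.

Lemma mul_invg_continuous g : continuous (fun y : G => (y^-1 * g)%g).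
Proof.
move=> y; have h1 : (fun z : G => (z^-1%g, g)) @ y --> (y^-1%g, g).
  by apply: cvg_pair; [exact: invg_continuous|exact: cvg_cst].
exact: cvg_comp h1 (mulg_continuous (y^-1%g, g)).
Qed.

Lemma compact_mul3 U V V' :
  compact U -> compact V -> compact V' -> compact (mul3 U V V').
Proof.
move=> cU cV cV'; apply: continuous_compact; last by do 2?apply: compact_setX.
apply: continuous_subspaceT => -[[x y] z].
have h1 : (fun p : G * G * G => p.1) @ ((x, y), z) --> (x, y).
  exact: cvg_fst.
have h2 : (fun p : G * G * G => (p.1.1 * p.1.2)%g) @ ((x, y), z) --> (x * y)%g.
  exact: cvg_comp h1 (mulg_continuous (x, y)).
have h3 : (fun p : G * G * G => ((p.1.1 * p.1.2)%g, p.2)) @ ((x, y), z) -->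
    ((x * y)%g, z).
  by apply: cvg_pair; [exact: h2|exact: cvg_snd].
exact: cvg_comp h3 (mulg_continuous ((x * y)%g, z)).
Qed.

Lemma compact_lmul g U : compact U -> compact [set (g * y)%g | y in U].
Proof.
move=> cU; apply: continuous_compact => //.
exact/continuous_subspaceT/mulg_continuous_l.
Qed.

Lemma compact_inv U : compact U -> compact [set (y^-1)%g | y in U].
Proof.
move=> cU; apply: continuous_compact => //.
exact/continuous_subspaceT/invg_continuous.
Qed.

Lemma nbhs1_mul U : nbhs (1 : G)%g U -> exists2 V, nbhs (1 : G)%g V &
  forall x y, V x -> V y -> U (x * y)%g.
Proof.
move=> nU; have := mulg_continuous (1%g : G, 1%g : G) => /(_ U).
rewrite /= mulg1 => /(_ nU)[[B C] [/= nB nC] BC].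
exists (B `&` C); first exact: filterI.
by move=> x y [Bx _] [_ Cy]; exact: (BC (x, y)).
Qed.

(** Two applications of [nbhs1_mul] make room for three factors; intersecting with the inverses
    makes the set symmetric. *)
Lemma nbhs1_shrink U : nbhs (1 : G)%g U -> exists V, [/\ nbhs (1 : G)%g V,
  (forall x, V x -> V x^-1%g) & mul3 V V V `<=` U].
Proof.
move=> /nbhs1_mul[V nV VU]; have [V2 nV2 V2V] := nbhs1_mul nV.
have nV3 : nbhs (1 : G)%g (V `&` V2) by exact: filterI.
exists ((V `&` V2) `&` [set x | (V `&` V2) x^-1%g]); split.
- apply: filterI => //; apply: invg_continuous; by rewrite invg1.
- by move=> x [h1 h2]; split => //=; rewrite invgK.
by move=> _ [[[x y] z] [[[/= [_ x2] _] [/= [_ y2] _]] [/= [z1 _] _]] <-];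
  apply: VU => //; exact: V2V.
Qed.

End GroupNeighborhoods.

(** * Compact exhaustion and neighborhood base at the identity *)

Section Struble.
Context {R : realType} {G : topologicalGroupType} (d : G -> G -> R).
Context (d_metric : is_metric d) (d_top : induces_topology d)
  (G_lc : locally_compact [set: G]) (G_sep : separable G).

Lemma locally_compact_nbhs {T : topologicalType} (x : T) :
  locally_compact [set: T] -> exists2 K, nbhs x K & compact K.
Proof. by move=> /(_ x I)[K]; rewrite withinET => nK [cK _]; exists K. Qed.

(** Each stage adds all triple products and a symmetrized translate of a compact neighborhood [K] of
    1 by the next point of a dense sequence; these translates cover [G]. *)
Lemma compact_exhaustion : exists C : nat -> set G,
  [/\ nbhs (1 : G)%g (C 0%N), forall k, compact (C k),
      forall k x, C k x -> C k x^-1%g,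
      forall k, mul3 (C k) (C k) (C k) `<=` C k.+1 &
      forall g, exists k, C k g].
Proof.
have [K nK cK] := locally_compact_nbhs (1%g : G) G_lc.
have [s sP] := dense_seq (1%g : G) d_metric d_top G_sep.
pose K' (U : set G) := U `|` [set (y^-1)%g | y in U].
have K'V U x : K' U x -> K' U x^-1%g.
  move=> [Ux|[y Uy <-]]; first by right; exists x.
  by left; rewrite invgK.
have cK' U : compact U -> compact (K' U).
  by move=> cU; apply: compactU => //; exact: compact_inv.
pose D k := K' [set (s k * y)%g | y in K].
pose C := fix C k := if k is m.+1 then mul3 (C m) (C m) (C m) `|` D m else K' K.
exists C; split.
- by apply: filterS nK => x; left.
- elim=> [|k IH] /=; first exact: cK'.
  apply: compactU; first exact: compact_mul3.
  exact/cK'/compact_lmul.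
- elim=> [|k IH] x /=; first exact: K'V.
  move=> [[[[a b] c] [[/= Ca Cb] Cc] <-]|/K'V]; last by right.
  by left; rewrite !invgM mulgA; apply: mul3I; exact: IH.
- by move=> k x; left.
(* The points [y] whose translate of [K] contains [g] form a neighborhood of [g], so some [s i] is
   among them. *)
move=> g; have : nbhs g [set y | K (y^-1 * g)%g].
  by apply: (@mul_invg_continuous G g g); rewrite mulVg.
move=> /nbhs_metric - /(_ _ _ d_top)[e e0 eK].
have [i] := sP g e e0; have [_ _ dC _] := d_metric.
rewrite dC => /eK /= Ki; exists i.+1; right; left.
by exists ((s i)^-1 * g)%g; rewrite ?mulVKg.
Qed.

Lemma neighborhood_base U : nbhs (1 : G)%g U -> exists A : nat -> set G,
  [/\ forall k, nbhs (1 : G)%g (A k), mul3 (A 0%N) (A 0%N) (A 0%N) `<=` U,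
      forall k x, A k x -> A k x^-1%g,
      forall k, mul3 (A k.+1) (A k.+1) (A k.+1) `<=` A k &
      forall V, nbhs (1 : G)%g V -> exists k, A k `<=` V].
Proof.
move=> nU; have /choice[sh shP] (V : set G) : exists V', nbhs (1 : G)%g V ->
    [/\ nbhs (1 : G)%g V', (forall x, V' x -> V' x^-1%g) & mul3 V' V' V' `<=` V].
  have [/nbhs1_shrink[V' h]|nV] := pselect (nbhs (1 : G)%g V); last by exists V.
  by exists V'.
pose B k := [set y | d 1%g y < k.+1%:R^-1].
have nB k : nbhs (1 : G)%g (B k).
  by apply/nbhs_metric => //; exists k.+1%:R^-1; rewrite ?invr_gt0.
(* Intersecting with the shrinking balls [B m] makes the sets a base. *)
pose A := fix A k := if k is m.+1 then sh (A m `&` B m) else sh U.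
have nA k : nbhs (1 : G)%g (A k).
  elim: k => [|k IH]; first by have [] := shP U nU.
  by have [] := shP (A k `&` B k); first exact: filterI.
have nAB k : nbhs (1 : G)%g (A k `&` B k) by exact: filterI.
have sub1 V : nbhs (1 : G)%g V -> V `<=` mul3 V V V.
  move=> /nbhs_singleton V1 x Vx.
  by exists ((1, 1), x)%g => //; rewrite /= !mul1g.
exists A; split => //.
- by have [] := shP U nU.
- by case=> [|k]; [have [] := shP U nU|have [] := shP _ (nAB k)].
- move=> k; have [_ _ h] := shP _ (nAB k).
  by move=> x /h [].
move=> V /nbhs_metric - /(_ _ _ d_top)[e e0 eV].
exists (Num.truncn e^-1).+1 => x Ax; apply: eV.
have [_ _ /(_ x (sub1 _ (nA _.+1) _ Ax))[_ Bx]] := shP _ (nAB (Num.truncn e^-1)).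
apply: (lt_trans Bx); rewrite -[ltRHS]invrK ltf_pV2 ?posrE ?invr_gt0//.
exact: truncnS_gt.
Qed.

End Struble.

Section StrubleMetric.
Context {R : realType} {G : topologicalGroupType} (d : G -> G -> R).
Context (d_metric : is_metric d) (d_top : induces_topology d)
  (G_lc : locally_compact [set: G]) (G_sep : separable G).

(* Chain metric of a sequence V n (n : int) of symmetric sets with
   V n V n V n in V (n + 1): those with n < 0 form a neighborhood base at 1, those
   with n >= 0 are compact and exhaust the group. *)
Lemma struble : exists2 rho : G -> G -> R, Metr_c R G rho &
  forall a g h, rho (a * g)%g (a * h)%g = rho g h.
Proof.
have [C [nC cC CV C3 Ccov]] := compact_exhaustion d_metric d_top G_lc G_sep.
have [A [nA A0 AV A3 Abase]] := neighborhood_base d_top nC.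
(* [Negz k] is [-(k + 1)], so [A 0] has index -1; its triple products lie in [C 0], which joins the
   two halves. *)
pose V (n : int) := match n with Posz k => C k | Negz k => A k end.
have VV n x : V n x -> V n x^-1%g by case: n => k; [exact: CV|exact: AV].
have V3 n : mul3 (V n) (V n) (V n) `<=` V (n + 1).
  case: n => [k|[|k]]; first by rewrite -PoszD addn1; exact: C3.
    exact: A0.
  rewrite (_ : Negz k.+1 + 1 = Negz k); first exact: A3.
  by rewrite !NegzE -[in X in _ = X]addn1 -[in X in X + _]addn1 PoszD opprD subrK addn1.
have A1 k : A k 1%g by exact: nbhs_singleton.
have C1 k : C k 1%g.
  elim: k => [|k IH]; first exact: nbhs_singleton.
  by apply: C3; have := mul3I IH IH IH; rewrite !mulg1.
have V1 n : V n 1%g by case: n => k /=.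
have Vmono m n : m <= n -> V m `<=` V n.
  rewrite -subr_ge0; case E : (n - m) => [k|//] _.
  have -> : n = m + k%:Z by rewrite -E addrC subrK.
  elim: k {E n} => [|k IH] x Vx; first by rewrite addr0.
  rewrite -addn1 PoszD addrA; apply: V3.
  by have := mul3I (IH _ Vx) (V1 _) (V1 _); rewrite !mulg1.
(* Powers of 2 turn the step from [n] to [n + 1] into the doubling of the radius. *)
pose W (t : R) : set G := [set x | exists2 n : int, 2%:R ^ n <= t & V n x].
have pow_gt0 n : 0 < (2%:R : R) ^ n by rewrite exprz_gt0.
have pow_small t : 0 < t -> exists k, (2%:R : R) ^ (Negz k) <= t.
  move=> t0; exists (Num.truncn t^-1).
  rewrite NegzE -exprnN -[leRHS]invrK lef_pV2 ?posrE ?invr_gt0 ?exprn_gt0//.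
  apply/ltW/(lt_le_trans (truncnS_gt _)).
  by rewrite -natrX ler_nat ltnW// ltn_expl.
have pow_large t : exists k, t <= (2%:R : R) ^ (Posz k).
  exists (Num.truncn t).+1; apply/ltW/(lt_le_trans (truncnS_gt _)).
  by rewrite -exprnP -natrX ler_nat ltnW// ltn_expl.
have nW t : 0 < t -> nbhs (1 : G)%g (W t).
  move=> /pow_small[k kt]; apply: filterS (nA k) => x Ax.
  by exists (Negz k).
have W1 t : 0 < t -> W t 1%g by move=> /nW /nbhs_singleton.
have W_mono t u : t <= u -> W t `<=` W u.
  by move=> tu x [n nt Vx]; exists n => //; exact: le_trans tu.
have W3 t x y z : 0 < t -> W t x -> W t y -> W t z -> W (2 * t) (x * y * z)%g.
  move=> t0 [i it Vx] [j jt Vy] [k kt Vz].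
  have [n [nt n1 n2 n3]] : exists n, [/\ (2%:R : R) ^ n <= t, i <= n, j <= n & k <= n].
    case: (leP i j) => ij; [case: (leP j k) => jk|case: (leP i k) => jk].
    - by exists k; rewrite (le_trans ij jk).
    - by exists j; rewrite (ltW jk).
    - by exists k; rewrite (le_trans (ltW ij) jk).
    - by exists i; rewrite (ltW ij) (ltW jk).
  exists (n + 1); first by rewrite (expfzDr n 1) ?pnatr_eq0// -exprnP expr1 mulrC ler_pM2l.
  by apply: V3; apply: mul3I; [apply: Vmono Vx|apply: Vmono Vy|apply: Vmono Vz].
have WV t x : W t x -> W t x^-1%g by move=> [n nt /VV h]; exists n.
have W_base U : nbhs (1 : G)%g U -> exists2 t, 0 < t & W t `<=` U.
  move=> /Abase[k kU]; exists (2%:R ^ (Negz k)) => // x [n].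
  rewrite ler_eXz2l ?ltr1n// => nk Vx; apply: kU; exact: (Vmono _ (Negz k) nk).
have W_cover g : exists2 t, 0 < t & W t g.
  have [k kg] := Ccov g; exists (2%:R ^ (Posz k)) => //; by exists (Posz k).
have W_sep g : (forall t, 0 < t -> W t g) -> g = 1%g.
  move=> Wg; have [d0 d1 _ _] := d_metric; apply/esym/d1/eqP.
  rewrite eq_le metric_ge0// andbT leNgt; apply/negP => e0.
  have /W_base[t /Wg + tU] : nbhs (1 : G)%g [set y | d 1%g y < d 1%g g].
    by apply/nbhs_metric => //; exists (d 1%g g).
  by move=> /tU /=; rewrite ltxx.
have W_compact t : exists2 K, compact K & W t `<=` K.
  have [k tk] := pow_large t; exists (C k) => // x [n nt Vx].
  apply: (Vmono n (Posz k)) Vx.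
  by rewrite -(@ler_eXz2l R 2%:R) ?ltr1n//; exact: le_trans tk.
have rhom := chain_dist_metric W1 W_mono W3 W_cover W_sep.
have len_lt := chain_length_lt W1 W_mono W3 W_cover.
exists (chain_dist W); last exact: chain_dist_inv.
have rhoi : induces_topology (chain_dist W).
  move=> g; rewrite predeqE => U; split.
    move=> nU; have /W_base[t t0 tU] : nbhs (1 : G)%g [set y | U (g * y)%g].
      by apply: mulg_continuous_l; rewrite mulg1.
    exists (t / 2) => /=; first by rewrite divr_gt0.
    move=> y; rewrite /= /chain_dist gt_max => /andP[/len_lt + _].
    by rewrite mulrC divfK ?pnatr_eq0// => /tU /=; rewrite mulVKg.
  move=> [e /= e0 eU]; have e2 : 0 < e / 2 by rewrite divr_gt0.
  have : nbhs g [set y | W (e / 2) (y^-1 * g)%g].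
    by apply: (@mul_invg_continuous G g g); rewrite mulVg; exact: nW.
  apply: filterS => y Wy; apply: eU; rewrite /= /chain_dist gt_max.
  have := WV _ _ Wy; rewrite invgM invgK => Wy'.
  have := chain_length_le W_cover e2 Wy; have := chain_length_le W_cover e2 Wy'.
  lra.
(* Length at most [r] is less than [r + 1], so the closed ball around [x] lies in the translate of
   [W (2 * (r + 1))] by [x]. *)
split => // x r; have [K cK WK] := W_compact (2 * (r + 1)).
have cxK := @compact_lmul G x _ cK.
apply: (subclosed_compact _ cxK); first exact: closed_metric_ball.
move=> y; rewrite /= /chain_dist ge_max => /andP[le _].
exists (x^-1 * y)%g; last by rewrite mulVKg.
by apply/WK/len_lt; lra.
Qed.

End StrubleMetric.

(** * Proper metrics on spaces *)

Section ProperMetric.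
Context {R : realType} {X : topologicalType} (e : X -> X -> R).
Context (e_metric : is_metric e) (e_top : induces_topology e)
  (X_lc : locally_compact [set: X]) (X_sep : separable X).

Let exx x : e x x = 0. Proof. by case: e_metric. Qed.
Let eC x y : e x y = e y x. Proof. by case: e_metric. Qed.
Let eT y x z : e x z <= e x y + e y z. Proof. by case: e_metric. Qed.
Let e_ge0 x y : 0 <= e x y. Proof. exact: metric_ge0. Qed.

Lemma compact_ball_cover : X -> exists (s : nat -> X) (r : nat -> R),
  [/\ forall i, r i <= 1, forall i, 0 < r i -> compact [set y | e (s i) y <= r i] &
      forall x, exists i, e (s i) x < r i].
Proof.
move=> x0; have [s sP] := dense_seq x0 e_metric e_top X_sep.
pose c (i : nat) : nat * nat := odflt (0%N, 0%N) (unpickle i).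
pose q (k : nat) : R := k.+1%:R^-1.
pose ok i := `[< compact [set y | e (s (c i).1) y <= q (c i).2] >].
(* Radius 0 discards the balls that are not compact, as no point is at distance less than 0. *)
exists (fun i => s (c i).1), (fun i => if ok i then q (c i).2 else 0); split.
- by move=> i; case: ifP => // _; rewrite invf_le1 ?ler1n.
- by move=> i; case: ifP => [/asboolP//|_]; rewrite ltxx.
move=> x; have [K nK cK] := locally_compact_nbhs x X_lc.
move: nK => /(nbhs_metric _ _ e_top)[t t0 tK].
have [k kt] : exists k, q k < t / 2.
  exists (Num.truncn (t / 2)^-1); rewrite -[ltRHS]invrK ltf_pV2 ?posrE ?invr_gt0//.
    exact: truncnS_gt.
  by rewrite divr_gt0.
have q0 : 0 < q k by rewrite invr_gt0.
have [n nx] := sP x _ q0.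
exists (pickle (n, k)); rewrite /ok /c pickleK /= ifT//; apply/asboolP.
apply: (subclosed_compact _ cK); first exact: closed_metric_ball.
by move=> y /= ny; apply: tK; have := eT (s n) x y; rewrite (eC x (s n)); lra.
Qed.

(** [theta] is a weighted sum of bumps on a countable cover by compact balls. Where it is at least
    [c], the tail is too small to account for it, so one of finitely many bumps is positive. *)
Lemma distance_to_infinity : X -> exists theta : X -> R,
  [/\ forall x, 0 < theta x, forall x y, `|theta x - theta y| <= e x y / 4 &
      forall c, 0 < c -> exists2 K, compact K & [set x | c <= theta x] `<=` K].
Proof.
move=> /compact_ball_cover[s [r [r1 cr cov]]].
pose f i x : R := Num.max 0 (r i - e (s i) x).
have f0 i x : 0 <= f i x by rewrite le_max lexx.
have f1 i x : f i x <= 1 by rewrite ge_max ler01 /=; have := e_ge0 (s i) x; have := r1 i; lra.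
have fl i x y : `|f i x - f i y| <= e x y.
  apply: (le_trans (max0_dist _ _)); rewrite ler_norml.
  have := eT x (s i) y; have := eT y (s i) x; rewrite (eC y x).
  by move: (r i) (e _ _) (e _ _) (e _ _) => ? ? ? ?; lra.
have bf x i : `|eps i * f i x| <= 1 * eps i.
  by rewrite ger0_norm ?mulr_ge0 ?eps_ge0// mulrC ler_wpM2r ?eps_ge0.
have bs x : eps_bounded (fun i => eps i * f i x) by exists 1.
exists (fun x => ssum (fun i => eps i * f i x)); split.
- move=> x; have [i ix] := cov x.
  apply: (@lt_le_trans _ _ (eps i * f i x)); last first.
    apply: (@ssum_ge R (fun i => eps i * f i x)) => // j.
    by rewrite mulr_ge0 ?eps_ge0.
  by rewrite mulr_gt0 ?eps_gt0// lt_max subr_gt0 ix orbT.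
- move=> x y; rewrite -ssumB//; apply: ssum_le => i.
  rewrite -mulrBr normrM ger0_norm ?eps_ge0// mulrC.
  by rewrite ler_wpM2r ?eps_ge0.
move=> c c0; have [N Nc] : exists N, @eps R N < c / 2.
  by apply: eps_small; rewrite divr_gt0.
exists (\big[setU/set0]_(i < N | 0 < r i) [set y | e (s i) y <= r i]).
  by apply: bigsetU_compact => i; exact: cr.
move=> x /= cx; have := ssum_tail N (bf x) => /(le_trans (ler_norm _)) h.
have : 0 < \sum_(0 <= i < N) eps i * f i x by lra.
rewrite big_mkord => S0.
have [i fi] : exists i : 'I_N, 0 < f i x.
  apply: contrapT => H; move: S0; rewrite big1 ?ltxx// => i _.
  rewrite (_ : f i x = 0) ?mulr0//; apply/eqP; rewrite eq_le f0 andbT leNgt.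
  by apply/negP => fi; apply: H; exists i.
move: fi; rewrite lt_max ltxx /= => fi; have := e_ge0 (s i) x => ei.
by rewrite (bigD1 i) /=; [left|]; lra.
Qed.

(** Adding the difference of the reciprocals of [theta] pushes infinity away: on a ball the
    reciprocal is bounded, so [theta] is bounded below and the ball lies in a compact set. *)
Lemma proper_metric_exists : exists d : X -> X -> R, Metr_c R X d.
Proof.
have [x0|noX] := pselect (inhabited X); last first.
  exists e; split => // x; by exfalso; apply: noX.
have [theta [t0 tl tc]] : exists theta : X -> R,
  [/\ forall x, 0 < theta x, forall x y, `|theta x - theta y| <= e x y / 4 &
      forall c, 0 < c -> exists2 K, compact K & [set x | c <= theta x] `<=` K].
  by case: x0 => x0; exact: distance_to_infinity.
pose d x y : R := e x y + `|(theta x)^-1 - (theta y)^-1|.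
have dm : is_metric d.
  split.
  - by move=> x; rewrite /d exx subrr normr0 addr0.
  - move=> x y h; case: e_metric => _ + _ _; apply.
    by have := e_ge0 x y; have := normr_ge0 ((theta x)^-1 - (theta y)^-1);
      rewrite /d in h; lra.
  - by move=> x y; rewrite /d eC distrC.
  - move=> y x z; rewrite /d; have := eT y x z.
    by have := ler_distD (theta y)^-1 (theta x)^-1 (theta z)^-1; lra.
have di : induces_topology d.
  apply: (induces_topology_equiv e_top) => x u u0.
    (* The second bound keeps [theta y] above [3 / 4] of [theta x]; given this, the third makes the
       reciprocals differ by less than [u / 2]. *)
    exists (Num.min (u / 2) (Num.min (theta x) (u * theta x ^+ 2 / 2))).
      by rewrite !lt_min t0 !divr_gt0// mulr_gt0 ?exprn_gt0.
    move=> y; rewrite !lt_min => /and3P[h1 h2 h3].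
    have xy := tl x y; have := xy; rewrite ler_norml => /andP[k1 k2].
    have ty : theta x * (3 / 4) <= theta y by lra.
    rewrite /d (_ : _ - _ = (theta y - theta x) / (theta x * theta y)); last first.
      by rewrite mulrBl invfM mulrCA mulfV ?gt_eqF// mulr1 mulrA mulfV ?gt_eqF// mul1r.
    rewrite normrM distrC normfV (@ger0_norm _ (theta x * theta y)) ?mulr_ge0 ?ltW//.
    have t2 : 0 < theta x * theta y by rewrite mulr_gt0.
    suff : `|theta x - theta y| / (theta x * theta y) < u / 2 by lra.
    rewrite ltr_pdivrMr//; have := t0 x => tx.
    have : theta x * (theta x * (3 / 4)) <= theta x * theta y by rewrite ler_pM2l.
    move: h3 xy u0; rewrite expr2; nra.
  exists u => // y; rewrite /d.
  by have := normr_ge0 ((theta x)^-1 - (theta y)^-1); lra.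
exists d; split => // x r.
(* The absolute value keeps this positive for negative [r]. *)
have c0 : 0 < (theta x)^-1 + `|r| by rewrite ltr_wpDr ?invr_gt0.
have [|K cK tK] := tc ((theta x)^-1 + `|r|)^-1; first by rewrite invr_gt0.
apply: (subclosed_compact _ cK); first exact: closed_metric_ball.
move=> y /= dr; apply: tK; rewrite /= -[leRHS]invrK lef_pV2 ?posrE ?invr_gt0//.
move: dr; rewrite /d distrC; have := e_ge0 x y.
by have := ler_norm ((theta y)^-1 - (theta x)^-1); have := ler_norm r; lra.
Qed.

End ProperMetric.

Theorem corollary1p2 (R : realType) (G : topologicalGroupType)
  (X : topologicalType)
  (G_polish : polish R G) (G_lc : locally_compact [set: G])
  (X_polish : polish R X) (X_lc : locally_compact [set: X])
  (X_gt1 : exists x y : X, x <> y)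
  (GX_card : ~ ([set: G] #= `I_1 /\ [set: X] #= `I_2)%card) :
  exists2 d : G * X -> G * X -> R, Metr_c R (G * X)%type d &
    [/\ isometries d =
          [set f | exists a : G, f = fun p : G * X => ((a * p.1)%g, p.2)],
        iso_acts_freely d &
        topgroup_isomorphic (Iso d) G].
Proof.
case: G_polish => Gs [gG [gGm gGi _]]; case: X_polish => Xs [gX [gXm gXi _]].
have [dG dGp dG_inv] := struble gGm gGi G_lc Gs.
have [dX dXp] := proper_metric_exists gXm gXi X_lc Xs.
have [d dp dI] := rigid_sum_dist dGp dXp dG_inv Gs Xs X_gt1 GX_card.
exists d => //; have [x0 _] := X_gt1; split => //.
  exact: translations_act_freely.
exact: translations_isomorphic.
Qed.
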